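(* Let $K$ be a field of characteristic $0$ and let $A$ be a Cohen-Macaulay standard graded $K$-algebra of Krull dimension $d$. Let $r\geq1$ be an integer and $s=\left\lfloor\frac{(r-1)d}{r}\right\rfloor$. (i) If $r\geq\frac12(\deg h_A(t)+1)$, then $h_{A^{\langle r\rangle}}(t)$ is the $f$-polynomial of a flag simplicial complex. (ii) If $r\geq\deg h_A(t)$, then $h_{A^{\langle r\rangle}}(t)$ is unimodal and $g_{A^{\langle r\rangle}}(t)$ is the $f$-polynomial of a simplicial complex. (iii) Let $h_{A^{\langle r\rangle}}(t)=\sum_{i\geq0}h_i^{\langle r\rangle}t^i$. Then $h_i^{\langle r\rangle}\leq h_{s-i}^{\langle r\rangle}$ for all integers $0\le i\leq\frac s2$.
   Context: A standard graded $K$-algebra is a commutative graded $K$-algebra $A=\bigoplus_{i\ge 0}A_i$ with $A_0=K$ that is generated as a $K$-algebra by the finite-dimensional space $A_1$. Its Hilbert series $\mathrm{Hilb}(A,t)=\sum_{i\ge0}(\dim_K A_i)t^i$ has the form $(h_0+h_1t+\cdots+h_\sigma t^\sigma)/(1-t)^d$, where $d=\dim A$ is the Krull dimension and the $h_i$ are integers. The polynomial $h_A(t)=h_0+h_1t+\cdots+h_\sigma t^\sigma$ (with $h_\sigma\ne0$) is the $h$-polynomial of $A$, and $g_A(t)=h_0+(h_1-h_0)t+\cdots+(h_{\lfloor\sigma/2\rfloor}-h_{\lfloor\sigma/2\rfloor-1})t^{\lfloor\sigma/2\rfloor}$ is the $g$-polynomial of $A$. For an integer $r\ge1$, the $r$th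 Veronese subalgebra is $A^{\langle r\rangle}=\bigoplus_{i\ge0}A_{ir}$, graded by $(A^{\langle r\rangle})_i=A_{ir}$; it is again a standard graded $K$-algebra, and $h_{A^{\langle r\rangle}}(t)$, $g_{A^{\langle r\rangle}}(t)$ are its $h$- and $g$-polynomials. A polynomial $h_0+h_1t+\cdots+h_\sigma t^\sigma\in\mathbb{Z}_{\ge0}[t]$ is unimodal if there is $0\le p\le\sigma$ with $h_0\le h_1\le\cdots\le h_p\ge h_{p+1}\ge\cdots\ge h_\sigma$. A simplicial complex $\Delta$ on $[n]=\{1,\dots,n\}$ is a collection of subsets of $[n]$ such that $F\in\Delta$ and $G\subset F$ imply $G\in\Delta$. It is flag if every minimal non-face of $\Delta$ has cardinality $\le2$. Let $f_i(\Delta)$ be the number of $F\in\Delta$ with $|F|=i+1$, with $f_{-1}(\Delta):=1$; the $f$-polynomial of $\Delta$ is $f(\Delta,t)=\sum_{i\ge0}f_{i-1}(\Delta)t^i$. *)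

(* Defs.v *)
(* Over classical logic (boolp) every subset of A is represented by a {pred A}, so
   quantifying over {pred A} quantifies over all subsets. *)
From HB Require Import structures.
From mathcomp Require Import all_boot all_order all_algebra ring_quotient.
From mathcomp Require Import boolp classical_sets.

Set Implicit Arguments.
Unset Strict Implicit.
Unset Printing Implicit Defensive.

Import Order.TTheory GRing.Theory Num.Theory.
Local Open Scope ring_scope.

(* [has_dim V n]: the subspace V of E has a basis of n elements. *)
Definition has_dim (K : fieldType) (E : lmodType K) (V : {pred E}) (n : nat)
    : Prop :=
  exists e : 'I_n -> E,
    (forall c : 'I_n -> K, \sum_i c i *: e i = 0 -> forall i, c i = 0) /\
    (forall v : E, v \in V <-> exists c : 'I_n -> K, v = \sum_i c i *: e i).

Record standard_grading (K : fieldType) (A : comAlgType K) := StandardGrading {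
  component :> nat -> {pred A};
  component_submod : forall i, GRing.submod_closed (component i);
  component_mul : forall i j x y,
    x \in component i -> y \in component j -> x * y \in component (i + j)%N;
  component0 : forall x, x \in component 0 <-> exists c : K, x = c%:A;
  component_span : forall x, exists (n : nat) (c : nat -> A),
    (forall i, c i \in component i) /\ x = \sum_(i < n) c i;
  component_direct : forall (n : nat) (c : nat -> A),
    (forall i, c i \in component i) -> \sum_(i < n) c i = 0 ->
    forall i, (i < n)%N -> c i = 0;
  component1_fin : exists n, has_dim (component 1) n;
  component1_generates : forall S : {pred A},
    GRing.subalg_closed S -> {subset component 1 <= S} -> forall x, x \in S
}.

Section Dimension.
Variable R : comNzRingType.

(* [idealr_closed] includes properness (1 \notin P). *)
Definition prime_ideal (P : {pred R}) : Prop :=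
  idealr_closed P /\ prime_idealr_closed P.

Definition prime_chain (n : nat) (P : nat -> {pred R}) : Prop :=
  (forall i, (i <= n)%N -> prime_ideal (P i)) /\
  (forall i, (i < n)%N ->
    {subset P i <= P i.+1} /\ exists2 x, x \in P i.+1 & x \notin P i).

Definition has_krull_dim (d : nat) : Prop :=
  (exists P, prime_chain d P) /\
  (forall n P, prime_chain n P -> (n <= d)%N).

Definition in_ideal (s : seq R) (y : R) : Prop :=
  exists c : nat -> R, y = \sum_(i < size s) c i * s`_i.

Definition regular_seq (s : seq R) : Prop :=
  ~ in_ideal s 1 /\
  forall i, (i < size s)%N ->
    forall y, in_ideal (take i s) (s`_i * y) -> in_ideal (take i s) y.

End Dimension.

Section CohenMacaulay.
Variables (K : fieldType) (A : comAlgType K) (G : standard_grading A).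

Definition homogeneous_regular_seq (s : seq A) : Prop :=
  regular_seq s /\
  forall x, x \in s -> exists2 j, (0 < j)%N & x \in G j.

Definition has_depth (n : nat) : Prop :=
  (exists2 s, homogeneous_regular_seq s & size s = n) /\
  (forall s, homogeneous_regular_seq s -> (size s <= n)%N).

(* depth A = dim A, in the graded sense. *)
Definition cohen_macaulay : Prop :=
  exists2 n, has_depth n & has_krull_dim A n.

End CohenMacaulay.

Section Veronese.
Variables (K : fieldType) (A : comAlgType K) (G : standard_grading A) (r : nat).

Definition veronese_pred : {pred A} := fun x =>
  `[< exists (n : nat) (c : nat -> A),
        (forall i, c i \in G (i * r)%N) /\ x = \sum_(i < n) c i >].

Lemma veronese_predP x : reflect (exists (n : nat) (c : nat -> A),
  (forall i, c i \in G (i * r)%N) /\ x = \sum_(i < n) c i) (x \in veronese_pred).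
Proof. exact: asboolP. Qed.

Lemma component_0 i : 0 \in G i.
Proof. by case: (component_submod G i). Qed.

Lemma component_lin i a x y : x \in G i -> y \in G i -> a *: x + y \in G i.
Proof. by move=> Gx Gy; case: (component_submod G i) => _; apply. Qed.

Lemma veronese_component i x : x \in G (i * r)%N -> x \in veronese_pred.
Proof.
move=> Gx; apply/veronese_predP.
exists i.+1, (fun j => if j == i then x else 0); split.
  by move=> j; case: eqP => [->|_] //; apply: component_0.
rewrite (bigD1 ord_max) //= eqxx big1 ?addr0 // => j.
by rewrite -val_eqE /= => /negPf ->.
Qed.

Lemma veronese_lin : GRing.linear_closed veronese_pred.
Proof.
move=> a x y /veronese_predP [m [c [Gc ->]]] /veronese_predP [n [e [Ge ->]]].
apply/veronese_predP; exists (maxn m n).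
exists (fun i => a *: (if (i < m)%N then c i else 0)
                 + (if (i < n)%N then e i else 0)).
split=> [i|].
  by apply: component_lin; case: ifP => _ //; apply: component_0.
rewrite big_split /= -scaler_sumr; congr (_ *: _ + _).
  rewrite (big_ord_widen (maxn m n) c) ?leq_maxl //.
  by rewrite [LHS]big_mkcond.
rewrite (big_ord_widen (maxn m n) e) ?leq_maxr //.
by rewrite [LHS]big_mkcond.
Qed.

Lemma veronese_0 : 0 \in veronese_pred.
Proof. by apply: (veronese_component (i := 0)); apply: component_0. Qed.

Lemma veronese_sum n (c : 'I_n -> A) :
  (forall i, c i \in veronese_pred) -> \sum_i c i \in veronese_pred.
Proof.
move=> Vc; apply: (big_ind (fun x => x \in veronese_pred)) => //.
  exact: veronese_0.
by move=> x y Vx Vy; rewrite -[x]scale1r; apply: veronese_lin.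
Qed.

Fact veronese_subalg_closed : GRing.subalg_closed veronese_pred.
Proof.
split.
- apply: (veronese_component (i := 0)); apply/component0.
  by exists 1; rewrite scale1r.
- exact: veronese_lin.
move=> x y /veronese_predP [m [c [Gc ->]]] /veronese_predP [n [e [Ge ->]]].
rewrite mulr_suml; apply: veronese_sum => i.
rewrite mulr_sumr; apply: veronese_sum => j.
apply: (veronese_component (i := (i + j)%N)).
by rewrite mulnDl; apply: component_mul.
Qed.

HB.instance Definition _ :=
  GRing.isSubalgClosed.Build K A veronese_pred
    (GRing.subalg_closed_semi veronese_subalg_closed).

Record veronese := Veronese {
  veronese_val :> A;
  veronese_valP : veronese_val \in veronese_pred
}.

HB.instance Definition _ := [isSub for veronese_val].
HB.instance Definition _ := [Choice of veronese by <:].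
HB.instance Definition _ := [SubChoice_isSubComNzRing of veronese by <:].
HB.instance Definition _ := [SubZmodule_isSubLmodule of veronese by <:].
HB.instance Definition _ := [SubNzRing_SubLmodule_isSubLalgebra of veronese by <:].
HB.instance Definition _ := [SubLalgebra_isSubAlgebra of veronese by <:].

Definition veronese_grading (i : nat) : {pred veronese} :=
  fun x => veronese_val x \in G (i * r)%N.

End Veronese.

Section HPolynomial.
Variables (K : fieldType) (A : comAlgType K) (G : nat -> {pred A}).

(* Hilb(A,t) (1 - t)^d = h(t) with d the Krull dimension of A; the right-hand
   side below is the n-th coefficient of the product. *)
Definition is_hpoly (h : {poly int}) : Prop :=
  exists (d : nat) (H : nat -> nat),
    [/\ has_krull_dim A d,
        forall i, has_dim (G i) (H i)
      & forall n, h`_n =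
          \sum_(j < n.+1) ((1 - 'X : {poly int}) ^+ d)`_j * (H (n - j)%N)%:Z].

(* At most one h satisfies [is_hpoly], and one exists for every standard
   grading by Hilbert-Serre; otherwise the value is the dummy 0. *)
Definition hpoly : {poly int} := xget 0 [set h | is_hpoly h]%classic.

End HPolynomial.

Definition deg (h : {poly int}) : nat := (size h).-1.

Definition gpoly (h : {poly int}) : {poly int} :=
  \poly_(i < ((deg h)./2).+1) (if i is j.+1 then h`_j.+1 - h`_j else h`_0).

Definition unimodal (h : {poly int}) : Prop :=
  (forall i, 0 <= h`_i) /\
  exists p, [/\ (p <= deg h)%N,
    forall i, (i < p)%N -> h`_i <= h`_i.+1
  & forall i, (p <= i)%N -> (i < deg h)%N -> h`_i.+1 <= h`_i].

Section Complexes.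
Variable n : nat.
Implicit Type D : {set {set 'I_n}}.

Definition simplicial_complex D : Prop :=
  forall F E : {set 'I_n}, F \in D -> E \subset F -> E \in D.

Definition flag D : Prop :=
  forall F : {set 'I_n}, minset (fun E => E \notin D) F -> (#|F| <= 2)%N.

(* The coefficient of t^i counts the faces of cardinality i; the constant
   coefficient is 1 by convention, including for the void complex. *)
Definition fpoly D : {poly int} :=
  \poly_(i < n.+1)
    (if i == 0%N then 1 else #|[set F in D | #|F| == i]|%:Z).

End Complexes.

Definition is_fpoly (f : {poly int}) : Prop :=
  exists (n : nat) (D : {set {set 'I_n}}), simplicial_complex D /\ f = fpoly D.

Definition is_flag_fpoly (f : {poly int}) : Prop :=
  exists (n : nat) (D : {set {set 'I_n}}),
    [/\ simplicial_complex D, flag D & f = fpoly D].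

(* Main.v *)
Require Import Defs.
From mathcomp Require Import all_boot all_order all_algebra.
From mathcomp Require Import ring_quotient zify ring boolp.
From mathcomp Require classical_sets.
Import Order.TTheory GRing.Theory Num.Theory.
Set Implicit Arguments.
Unset Strict Implicit.
Unset Printing Implicit Defensive.

(** The statement is numerical once the right monomials are found.

    Commutative algebra supplies a multicomplex. Over an infinite field the elements of a
    homogeneous regular sequence of length [d] can be replaced by linear forms one at a
    time ([linear_regular_sequence]): modulo all the others the components have bounded
    dimension, so two linear forms [u], [v] satisfy a homogeneous equation, and
    eliminating [v] repeatedly yields a linear form that divides a power of the element
    to be replaced, hence is regular as well. Modulo the linear sequence the algebra is
    finite-dimensional, because otherwise the primes obtained by descending from a prime
    strictly below the irrelevant ideal would form a chain longer than the dimension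
    ([quotient_finite]). The Hilbert function of this quotient is [h_A]; it counts the
    monomials that are not combinations of smaller ones, and these are closed under
    divisors ([standard_subseq], [standard_basis]).

    The Veronese subalgebra has the same Krull dimension, since [A] is integral over it
    ([integral_krull_dim]). Comparing Hilbert series, its [h]-polynomial has as [i]-th
    coefficient the coefficient of [t^(i r)] in [h_A (1 + t + ... + t^(r-1))^d]
    ([hilbert_veronese]). So it counts the monomials of degree [i r] in two groups of
    variables: a standard monomial times a monomial in [d] further variables with all
    exponents below [r].

    Writing such a monomial as a weakly increasing word and cutting the word into [i]
    blocks of length [r] turns it into a set of [i] monomials of degree [r]. No block
    repeats, because [x^(2r)] is excluded in both groups, so these sets are the faces of a
    simplicial complex ([card_block_complex]). If [h_A] has degree below [2 r], the
    letters of the first group fill at most two blocks, and a letter of the second group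
    meets at most two blocks; being a face is then a condition on pairs of blocks and the
    complex is flag ([block_complex_flag], [veronese_flag]).

    For the [g]-polynomial, multiplication by [1 - t^r] changes
    [(1 + ... + t^(r-1))^d] into [(1 - t) (1 + ... + t^(r-1))^(d+1)]. Up to the middle
    degree the coefficients of the latter count the monomials in [d + 1] variables that
    are the bottoms of the chains in the bracketing decomposition of a product of chains,
    and these satisfy a ballot condition that is closed under divisors
    ([size_ballot_words]); the same cutting into blocks gives the complex
    ([veronese_gpoly]). Unimodality and the remaining inequalities compare sums term by
    term, using that the coefficients of [(1 + ... + t^(r-1))^d] are symmetric and
    increase towards the middle ([coef_geo_le], [coef_geo_ge]). *)

(** * Complexes of blocks *)

Local Open Scope nat_scope.

Definition enumerates (L : nat -> seq (seq nat)) (Q : pred (seq nat)) :=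
  forall m, uniq (L m) /\ forall w, (w \in L m) = Q w && (size w == m).

Lemma sorted_leq_cat (u v : seq nat) :
  sorted leq (u ++ v) = [&& allrel leq u v, sorted leq u & sorted leq v].
Proof. by rewrite !(sorted_pairwise leq_trans) pairwise_cat. Qed.

Lemma sorted_cat_trans (u v w : seq nat) : 0 < size v ->
  sorted leq (u ++ v) -> sorted leq (v ++ w) -> sorted leq (u ++ w).
Proof.
case: v => // y v _; rewrite !sorted_leq_cat.
move=> /and3P[/allrelP uv -> _] /and3P[/allrelP vw _ ->]; rewrite !andbT.
apply/allrelP => a b ua wb; apply: (@leq_trans y).
  by apply: uv; rewrite ?mem_head.
by apply: vw; rewrite ?mem_head.
Qed.

(** Two words of the same length that can be concatenated in both orders are
    constant, with the same letter. *)
Lemma sorted_cat_anti (u v : seq nat) : size u = size v ->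
  sorted leq (u ++ v) -> sorted leq (v ++ u) -> u = v.
Proof.
rewrite !sorted_leq_cat => suv /and3P[/allrelP uv _ _] /and3P[/allrelP vu _ _].
have E x y : x \in u -> y \in v -> x = y.
  by move=> ux vy; apply/eqP; rewrite eqn_leq uv ?vu.
apply: (@eq_from_nth _ 0) => // i iu.
by apply: E; rewrite mem_nth // -suv.
Qed.

Section BlockComplex.

Variables (r : nat) (Q : pred (seq nat)) (L : nat -> seq (seq nat)).
Hypothesis r_gt0 : 0 < r.
Hypothesis Q_sorted : forall w, Q w -> sorted leq w.
Hypothesis Q_subseq : forall u w, subseq u w -> Q w -> Q u.
Hypothesis Q_square : forall u, size u = r -> ~~ Q (u ++ u).
Hypothesis L_enum : enumerates L Q.

Let N := size (L r).
Let block (i : 'I_N) : seq nat := nth [::] (L r) i.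

Definition block_word (ts : seq 'I_N) := flatten (map block ts).

(** The faces are the sets of blocks that can be arranged to a word in [Q]. The bound [b]
    on their number truncates the complex, as the g-polynomial requires. *)
Definition block_complex (b : nat) : {set {set 'I_N}} :=
  [set F : {set 'I_N} | `[< exists ts : seq 'I_N,
     [/\ uniq ts, F =i ts, size ts <= b & Q (block_word ts)] >]].

Let block_in i : block i \in L r. Proof. exact: mem_nth. Qed.

Let size_block i : size (block i) = r.
Proof. by move: (block_in i); rewrite (L_enum r).2 => /andP[_ /eqP]. Qed.

Let block_inj : injective block.
Proof.
move=> i j /eqP; rewrite nth_uniq ?ltn_ord ?(L_enum r).1 // => /eqP.
exact: val_inj.
Qed.

Let shape_blocks ts : shape (map block ts) = nseq (size ts) r.
Proof.
elim: ts => //= i ts IH; rewrite size_block; congr cons; exact: IH.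
Qed.

Let size_block_word ts : size (block_word ts) = size ts * r.
Proof. by rewrite size_flatten shape_blocks sumn_nseq mulnC. Qed.

Let block_word_inj ts ts' :
  size ts = size ts' -> block_word ts = block_word ts' -> ts = ts'.
Proof.
move=> sz E; apply: (inj_map block_inj).
by apply: eq_from_flatten_shape => //; rewrite !shape_blocks sz.
Qed.

Let block_word_subseq ts ts' :
  subseq ts ts' -> subseq (block_word ts) (block_word ts').
Proof.
elim: ts' ts => [|x ts' IH] [|y ts] //=; first by rewrite sub0seq.
case: eqP => [->|_] /IH H; first by apply: cat_subseq.
by apply: (subseq_trans H); apply: suffix_subseq.
Qed.

Let lt_block i j := (i != j) && sorted leq (block i ++ block j).

Let lt_block_trans : transitive lt_block.
Proof.
move=> j i k /andP[ij sij] /andP[jk sjk]; apply/andP; split.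
  apply: contra ij => /eqP ik; rewrite -ik in sjk.
  by apply/eqP/block_inj/sorted_cat_anti => //; rewrite !size_block.
by apply: sorted_cat_trans sij sjk; rewrite size_block.
Qed.

Let lt_block_irr : irreflexive lt_block.
Proof. by move=> i; rewrite /lt_block eqxx. Qed.

Let lt_block_sorted ts : Q (block_word ts) -> sorted lt_block ts.
Proof.
elim: ts => //= i [//|j ts] IH Qw /=; apply/andP; split; last first.
  by apply: IH; apply: Q_subseq Qw; apply: suffix_subseq.
have Qij : Q (block i ++ block j).
  apply: Q_subseq Qw.
  apply: cat_subseq => //; apply: prefix_subseq.
rewrite /lt_block (Q_sorted Qij) andbT; apply/eqP => ij.
by move: Qij; rewrite ij; apply/negP/Q_square; rewrite size_block.
Qed.

Let block_uniq ts : Q (block_word ts) -> uniq ts.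
Proof. by move/lt_block_sorted; apply: sorted_uniq. Qed.

Lemma block_complex_simplicial b : simplicial_complex (block_complex b).
Proof.
move=> F E; rewrite !inE => /asboolP[ts [uts Fts szts Qw]] /subsetP EF.
apply/asboolP; exists (filter (mem E) ts); split.
- exact: filter_uniq.
- by move=> x; rewrite mem_filter inE -Fts; case: (boolP (x \in E)) => //= /EF ->.
- by apply: leq_trans szts; rewrite size_filter count_size.
- by apply: Q_subseq Qw; apply: block_word_subseq; apply: filter_subseq.
Qed.

Let block_surj i w : w \in L (i * r) ->
  exists2 ts, size ts = i & block_word ts = w.
Proof.
elim: i w => [|i IH] w; rewrite (L_enum _).2 => /andP[Qw /eqP sw].
  by exists [::] => //; apply/esym/size0nil; rewrite sw.
have [|ts sts E] := IH (drop r w).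
  rewrite (L_enum _).2 size_drop sw mulSn addKn eqxx andbT.
  by apply: Q_subseq Qw; apply: drop_subseq.
have wr : take r w \in L r.
  rewrite (L_enum _).2 size_takel ?sw ?mulSn ?leq_addr // eqxx andbT.
  by apply: Q_subseq Qw; apply: take_subseq.
have ltN : index (take r w) (L r) < N by rewrite index_mem.
exists (Ordinal ltN :: ts); first by rewrite /= sts.
by rewrite /block_word /= -/(block_word ts) E /block /= nth_index ?cat_take_drop.
Qed.

(** Cutting a word into its blocks is injective, even after the order of the blocks is
    forgotten, since consecutive blocks are strictly increasing. *)
Lemma card_block_complex b i : i <= b ->
  #|[set F in block_complex b | #|F| == i]| = size (L (i * r)).
Proof.
move=> ib; pose TS := [set t : i.-tuple 'I_N | Q (block_word t)].
have TSE t : (t \in TS) = Q (block_word t) by rewrite inE.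
have -> : [set F in block_complex b | #|F| == i]
        = [set [set x in t] | t : i.-tuple 'I_N in TS].
  apply/setP => F; apply/idP/imsetP.
    rewrite !inE => /andP[/asboolP[ts [uts Fts szts Qw]] /eqP cF].
    have sts : size ts == i.
      by rewrite -cF -(card_uniqP uts); apply/eqP/eq_card => x; rewrite Fts.
    exists (Tuple sts); first by rewrite TSE.
    by apply/setP => x; rewrite inE Fts.
  case=> t; rewrite TSE => Qt ->; rewrite !inE; apply/andP; split.
    apply/asboolP; exists t; split=> //.
      exact: block_uniq Qt.
      by move=> x; rewrite inE.
    by rewrite size_tuple.
  by rewrite cardsE (card_uniqP (block_uniq Qt)) size_tuple.
rewrite card_in_imset; last first.
  move=> t t'; rewrite !TSE => /lt_block_sorted st /lt_block_sorted st' /setP E.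
  apply/val_inj/(irr_sorted_eq lt_block_trans lt_block_irr) => // x.
  by move: (E x); rewrite !inE.
rewrite cardE -(size_map (fun t : i.-tuple 'I_N => block_word t)).
apply: perm_size; apply: uniq_perm; last 1 first.
- move=> w; rewrite (L_enum _).2; apply/mapP/andP.
    case=> t; rewrite mem_enum TSE => Qt ->.
    by rewrite size_block_word size_tuple.
  move=> Qw; have [|ts /eqP sts E] := @block_surj i w.
    by rewrite (L_enum _).2; apply/andP.
  exists (Tuple sts) => //; rewrite mem_enum TSE /=.
  by rewrite E; case: Qw.
- rewrite map_inj_in_uniq ?enum_uniq // => t t' _ _ E.
  by apply/val_inj/block_word_inj => //; rewrite !size_tuple.
- exact: (L_enum _).1.
Qed.

Let subseq2 (T : eqType) (s : seq T) x y : x \in s -> y \in s -> x != y ->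
  subseq [:: x; y] s || subseq [:: y; x] s.
Proof.
move=> xs; case/splitPr: xs => p q; rewrite mem_cat inE eq_sym.
case/or3P => [yp _|/eqP-> /eqP//|yq _].
  apply/orP; right; rewrite (_ : [:: y; x] = [:: y] ++ [:: x]) //.
  by apply: cat_subseq; rewrite sub1seq ?mem_head.
apply/orP; left; rewrite -[[:: x; y]]cat0s; apply: cat_subseq.
  exact: sub0seq.
by rewrite /= eqxx sub1seq.
Qed.

(** A minimal non-face with three vertices or more would have all its pairs among
    the faces; ordering its vertices into a chain of blocks then makes it a face. *)
Lemma block_complex_flag b : N <= b ->
  (forall us : seq (seq nat), all (fun u => (size u == r) && Q u) us ->
     pairwise (fun u v => Q (u ++ v)) us -> Q (flatten us)) ->
  flag (block_complex b).
Proof.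
move=> Nb Qpair F /minsetP[nF minF]; rewrite leqNgt; apply/negP => cF.
have faceP (E : {set 'I_N}) : E \subset F -> #|E| < #|F| ->
    exists2 ts : seq 'I_N, E =i ts & Q (block_word ts).
  move=> EF cE; case: (boolP (E \in block_complex b)) => [|nE].
    by rewrite inE => /asboolP[ts [_ Ets _ Qw]]; exists ts.
  by move: cE; rewrite (minF E) ?ltnn.
have Q1 i : i \in F -> Q (block i).
  move=> iF; have [||ts Ets Qw] := faceP [set i].
  - by rewrite sub1set.
  - by rewrite cards1; apply: leq_trans cF.
  apply: Q_subseq Qw; rewrite -[block i]cats0.
  by apply: (@block_word_subseq [:: i]); rewrite sub1seq -Ets set11.
have Q2 i j : i \in F -> j \in F -> i != j ->
    Q (block i ++ block j) || Q (block j ++ block i).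
  move=> iF jF ij; have [||ts Ets Qw] := faceP [set i; j].
  - by rewrite subUset !sub1set iF.
  - by rewrite cards2 ij.
  have its : i \in ts by rewrite -Ets set21.
  have jts : j \in ts by rewrite -Ets set22.
  have /orP[S|S] := subseq2 its jts ij.
    apply/orP; left; apply: Q_subseq Qw.
    by rewrite -[block j]cats0; apply: block_word_subseq S.
  apply/orP; right; apply: Q_subseq Qw.
  by rewrite -[block i]cats0; apply: block_word_subseq S.
pose le i j := (i == j) || lt_block i j.
have le_trans : transitive le.
  move=> j i k /orP[/eqP->//|ij] /orP[/eqP<-|jk]; apply/orP; right=> //.
  exact: lt_block_trans ij jk.
pose ts := sort le (enum F).
have tsF : ts =i F by move=> x; rewrite mem_sort mem_enum.
have uts : uniq ts by rewrite sort_uniq enum_uniq.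
have sts : sorted le ts.
  apply: (@sort_sorted_in _ (mem F)); last by apply/allP => x; rewrite mem_enum.
  move=> i j iF jF; rewrite /le /lt_block [j == i]eq_sym.
  case: eqP => //= /eqP ij.
  by case/orP: (Q2 i j iF jF ij) => /Q_sorted ->; rewrite ?orbT.
case/negP: nF; rewrite inE; apply/asboolP; exists ts; split=> //.
  by apply: leq_trans Nb; rewrite -[leqRHS]card_ord -(card_uniqP uts) max_card.
apply: Qpair.
  by rewrite all_map; apply/allP => i; rewrite tsF => /Q1 /= ->;
    rewrite size_block eqxx.
rewrite pairwise_map.
have: pairwise [rel i j | le i j && (i != j)] ts.
  by rewrite pairwise_relI -(sorted_pairwise le_trans) sts /= -uniq_pairwise.
have tsF' : all (mem F) ts by apply/allP => x; rewrite tsF.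
apply: (sub_in_pairwise _ tsF') => i j iF jF /=.
case/andP=> /orP[->//|/andP[_ sij]] ij.
case/orP: (Q2 i j iF jF ij) => // /Q_sorted sji.
by move: ij; rewrite (block_inj (sorted_cat_anti _ sij sji)) ?eqxx // !size_block.
Qed.

End BlockComplex.

(** * Words with bounded multiplicities *)

Lemma sorted_leq_split n w : sorted leq w ->
  w = [seq x <- w | x < n] ++ [seq x <- w | n <= x].
Proof.
elim: w => //= x w IH xw; have sw := path_sorted xw.
case: ltnP => xn /=; first by rewrite -IH.
have /allP H := order_path_min leq_trans xw.
rewrite (@eq_in_filter _ (fun y => y < n) pred0) ?filter_pred0 /=.
  congr cons; rewrite (@eq_in_filter _ _ predT) ?filter_predT // => y /H /=.
  exact: leq_trans.
by move=> y /H /= xy; apply/negbTE; rewrite -leqNgt (leq_trans xn).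
Qed.

(** Monomials in the variables [0, ..., D-1] with all exponents below [r]. With
    [ballot], the exponents [a_k] also satisfy
    [a_k + 2 (a_0 + ... + a_(k-1)) <= k (r - 1)]: these are the bottoms of the
    chains in the bracketing decomposition of a product of [D] chains of length
    [r - 1] into symmetric chains. *)
Definition power_word (ballot : bool) (r D : nat) (w : seq nat) : bool :=
  [&& sorted leq w, all (fun x => x < D) w
    & all (fun k => (count_mem k w < r) &&
        (ballot ==> (count_mem k w + 2 * count (fun x => x < k) w <= k * r.-1)))
      (iota 0 D)].

Fixpoint power_words (ballot : bool) (r D m : nat) : seq (seq nat) :=
  if D is D'.+1 then
    [seq w ++ nseq a D' |
      a <- [seq a <- iota 0 r |
             (a <= m) && (ballot ==> (a + 2 * (m - a) <= D' * r.-1))],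
      w <- power_words ballot r D' (m - a)]
  else if m == 0 then [:: [::]] else [::].

(** A word in the letters up to [D] is a word in the smaller letters followed by a power
    of [D]. *)
Lemma power_words_enum ballot r D :
  enumerates (power_words ballot r D) (power_word ballot r D).
Proof.
elim: D => [|D IH] m.
  split; first by rewrite /=; case: eqP.
  case=> [|x w] /=; first by rewrite eq_sym; case: eqP.
  by rewrite /power_word /= !andbF; case: eqP.
have cntlt u k : all (fun x => x < D) u -> D <= k -> count_mem k u = 0.
  move=> uD Dk; apply/count_memPn/negP => /(allP uD) /= kD.
  by rewrite ltnNge Dk in kD.
split.
  apply: allpairs_uniq_dep; first by rewrite filter_uniq ?iota_uniq.
    by move=> a _; apply: (IH _).1.
  move=> _ _ /allpairsPdep[a [u [_ + ->]]] /allpairsPdep[b [v [_ + ->]]] /= E.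
  rewrite !(IH _).2 => /andP[/and3P[_ uD _] _] /andP[/and3P[_ vD _] _].
  have ab : a = b.
    have := congr1 (count_mem D) E; rewrite !count_cat !count_nseq /= eqxx !mul1n.
    by rewrite !cntlt.
  rewrite -{b}ab in E *; congr existT.
  have uv : size u = size v.
    by move/(congr1 size)/eqP: E; rewrite !size_cat eqn_add2r => /eqP.
  by move/eqP: E; rewrite eqseq_cat // => /andP[/eqP].
move=> w; apply/allpairsPdep/andP.
  case=> a [u [+ + ->]]; rewrite mem_filter mem_iota (IH _).2 /= add0n.
  case/andP=> /andP[am bal] ar /andP[/and3P[su uD cu] /eqP szu].
  split; last by rewrite size_cat size_nseq szu subnK.
  apply/and3P; split.
  - rewrite sorted_leq_cat su /=; apply/andP; split.
      apply/allrelP => x y xu; rewrite mem_nseq => /andP[_ /eqP->].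
      by apply/ltnW/(allP uD).
    by elim: (a) => //= -[//|k] /= ->; rewrite leqnn.
  - rewrite all_cat; apply/andP; split.
      by apply: sub_all uD => x /= /leqW.
    by apply/allP => x; rewrite mem_nseq => /andP[_ /eqP->] /=.
  apply/allP => k; rewrite mem_iota /= add0n ltnS leq_eqVlt => /orP[/eqP->|kD].
    rewrite !count_cat !count_nseq /= eqxx ltnn mul1n mul0n addn0.
    rewrite cntlt // add0n ar /=.
    by have /eqP-> : count (fun x => x < D) u == size u; rewrite -?all_count ?szu.
  rewrite !count_cat !count_nseq /= (gtn_eqF kD) [D < k]ltnNge (ltnW kD) /= !mul0n !addn0.
  by apply: (allP cu); rewrite mem_iota.
case=> /and3P[sw wD cw] /eqP szw.
set a := count_mem D w; set u := [seq x <- w | x < D].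
have Dw : [seq x <- w | D <= x] = nseq a D.
  have /all_pred1P -> : all (pred1 D) [seq x <- w | D <= x].
    apply/allP => x; rewrite mem_filter => /andP[Dx /(allP wD)] /=.
    by rewrite ltnS eqn_leq Dx => ->.
  rewrite size_filter; congr nseq; apply: eq_in_count => x /(allP wD) /=.
  by rewrite ltnS eqn_leq => ->.
have Ew : w = u ++ nseq a D by rewrite [LHS](sorted_leq_split D sw) Dw.
have szu : size u = m - a.
  by have := congr1 size Ew; rewrite size_cat size_nseq szw => ->; rewrite addnK.
have am : a <= m by rewrite -szw count_size.
have uD : all (fun x => x < D) u by apply: filter_all.
have := allP cw D; rewrite mem_iota /= add0n ltnSn => /(_ isT).
rewrite -/a -size_filter -/u szu => /andP[ar bal].
exists a, u; split => //; first by rewrite mem_filter am bal mem_iota.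
rewrite (IH _).2 szu eqxx andbT; apply/and3P; split=> //.
  exact: (sorted_filter leq_trans).
apply/allP => k; rewrite mem_iota /= add0n => kD.
have := allP cw k; rewrite mem_iota /= add0n (leqW kD) => /(_ isT).
have cntE p : count p w = count p u + p D * a.
  by rewrite [in LHS]Ew count_cat count_nseq.
by rewrite !cntE /= (gtn_eqF kD) [D < k]ltnNge (ltnW kD) !mul0n !addn0.
Qed.

Lemma power_word_subseq ballot r D u w :
  subseq u w -> power_word ballot r D w -> power_word ballot r D u.
Proof.
move=> uw /and3P[sw wD cw]; apply/and3P; split.
- exact: (subseq_sorted leq_trans uw).
- by apply/allP => x /(mem_subseq uw) /(allP wD).
apply/allP => k /(allP cw) /andP[kr kb]; rewrite (leq_ltn_trans _ kr) /=; last first.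
  exact: leq_count_subseq.
apply/implyP => /(implyP kb); apply: leq_trans.
by rewrite leq_add ?leq_mul ?leq_count_subseq.
Qed.

Lemma power_word_count ballot r D w k : 0 < r ->
  power_word ballot r D w -> count_mem k w < r.
Proof.
move=> r0 /and3P[_ wD cw]; case: (ltnP k D) => kD.
  by have := allP cw k; rewrite mem_iota /= add0n kD => /(_ isT) /andP[].
rewrite (_ : count_mem k w = 0) //; apply/count_memPn/negP => /(allP wD) /=.
by rewrite ltnNge kD.
Qed.

Lemma size_power_wordsS ballot r D m :
  size (power_words ballot r D.+1 m) =
  \sum_(0 <= a < r | (a <= m) && (ballot ==> (a + 2 * (m - a) <= D * r.-1)))
     size (power_words ballot r D (m - a)).
Proof. by rewrite size_allpairs_dep sumnE big_map big_filter /index_iota subn0. Qed.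

(** * Coefficients of powers of truncated geometric series *)

Local Open Scope ring_scope.

Definition geo (r : nat) : {poly int} := \sum_(0 <= i < r) 'X^i.

Lemma coef_geoM r (p : {poly int}) m :
  (geo r * p)`_m = \sum_(0 <= a < r | (a <= m)%N) p`_(m - a).
Proof.
rewrite mulr_suml coef_sum [RHS]big_mkcond; apply: eq_bigr => a _.
by rewrite coefXnM ltnNge; case: leqP.
Qed.

Lemma geo_mul1X r : geo r * (1 - 'X) = 1 - 'X^r.
Proof.
rewrite /geo; elim: r => [|r IH]; first by rewrite big_geq // mul0r expr0 subrr.
by rewrite big_nat_recr //= mulrDl IH exprSr mulrBr mulr1; ring.
Qed.

Lemma coef_geo r m : (geo r)`_m = (m < r)%:R.
Proof.
rewrite -[geo r]mulr1 coef_geoM; case: ltnP => mr.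
  rewrite big_mkcond (big_cat_nat (n := m)) //=; last exact: ltnW.
  rewrite big1_seq ?add0r; last first.
    move=> a /andP[_]; rewrite mem_index_iota => /andP[_ am].
    by rewrite (ltnW am) coef1 subn_eq0 leqNgt am.
  rewrite big_ltn // leqnn subnn coef1 /= big1_seq ?addr0 // => a.
  by rewrite mem_index_iota => /andP[_ /andP[ma _]]; rewrite leqNgt ma.
rewrite big1_seq // => a /andP[am]; rewrite mem_index_iota => /andP[_ ar].
by rewrite coef1 subn_eq0 leqNgt (leq_trans ar mr).
Qed.

Lemma coef_geo0 r D : (0 < r)%N -> (geo r ^+ D)`_0 = 1.
Proof.
move=> r0; elim: D => [|D IH]; first by rewrite expr0 coef1.
by rewrite exprS coef0M coef_geo r0 IH mulr1.
Qed.

Lemma size_geo r D : (0 < r)%N -> (size (geo r ^+ D) <= (D * r.-1).+1)%N.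
Proof.
move=> r0; apply: leq_trans (size_poly_exp_leq _ _) _.
rewrite ltnS mulnC leq_mul2l -!subn1 leq_sub2r ?orbT //.
by apply/leq_sizeP => j rj; rewrite coef_geo ltnNge rj.
Qed.

Lemma coef_geo_out r D m : (0 < r)%N -> (D * r.-1 < m)%N -> (geo r ^+ D)`_m = 0.
Proof. by move=> r0 Dm; apply: nth_default; apply: leq_trans (size_geo _ r0) Dm. Qed.

Lemma coef_geo_sym r D m : (0 < r)%N -> (m <= D * r.-1)%N ->
  (geo r ^+ D)`_m = (geo r ^+ D)`_(D * r.-1 - m).
Proof.
move=> r0; elim: D m => [|D IH] m mD; first by move: mD; rewrite leqn0 => /eqP->.
rewrite !exprS !coef_geoM big_nat_rev /= add0n [LHS]big_mkcond [RHS]big_mkcond.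
apply: eq_big_nat => a /andP[_ ar].
set q := r.-1 in mD IH *; have rq : r = q.+1 by rewrite /q prednK.
have -> : (r - a.+1 = q - a)%N by rewrite rq.
have aq : (a <= q)%N by rewrite -ltnS -rq.
rewrite mulSn in mD *.
case: (leqP (q - a) m) => H1; case: (leqP a (q + D * q - m)) => H2 //.
- by rewrite IH; [congr (_`_ _); lia|lia].
- by rewrite coef_geo_out //; lia.
- by rewrite coef_geo_out // -/q; lia.
Qed.

Lemma Posz_sum (I : Type) (s : seq I) (P : pred I) (F : I -> nat) :
  (\sum_(i <- s | P i) F i)%N%:Z = \sum_(i <- s | P i) (F i)%:Z.
Proof. exact: (big_morph Posz PoszD (erefl _)). Qed.

Lemma size_power_words r D m : (size (power_words false r D m))%:Z = (geo r ^+ D)`_m.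
Proof.
elim: D m => [|D IH] m; first by rewrite expr0 coef1 /=; case: eqP.
rewrite exprS coef_geoM size_power_wordsS Posz_sum.
by apply: eq_big => [a|a _]; rewrite ?andbT.
Qed.

(** The differences of the coefficients of [geo r ^+ D] are antisymmetric about the
    middle, so the terms of the convolution that the ballot condition excludes
    cancel in pairs; what is left is the next difference. *)
Lemma size_ballot_words r D m : (0 < r)%N -> (2 * m <= (D * r.-1).+1)%N ->
  (size (power_words true r D m))%:Z = (geo r ^+ D * (1 - 'X))`_m.
Proof.
move=> r0; elim: D m => [|D IH] m mD.
  by rewrite expr0 mul1r; case: m mD => [|m] /=; [rewrite coefB coefX coef1|lia].
set q := r.-1 in mD IH *; have rq : r = q.+1 by rewrite /q prednK.
pose p := geo r ^+ D * (1 - 'X); pose t := (2 * m - D * q)%N.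
(* The ballot condition excludes the exponents [a] of the last letter below [t]. *)
have tr : (t <= r)%N by rewrite /t rq; move: mD; rewrite mulSn; lia.
have Z : \sum_(0 <= a < t | (a <= m)%N) p`_(m - a) = 0.
  rewrite -coef_geoM mulrCA geo_mul1X mulrBr mulr1 coefB coefMXn.
  case: ltnP => mt; first by rewrite subr0 coef_geo_out // -/q; move: mt; rewrite /t; lia.
  case: (posnP t) => [->|t0]; first by rewrite subn0 subrr.
  have mDq : (m <= D * q)%N by move: mt; rewrite /t; lia.
  rewrite [X in X - _](coef_geo_sym (D := D) r0) //.
  by apply/eqP; rewrite subr_eq0; apply/eqP; congr (_`_ _); move: t0; rewrite /t -/q; lia.
rewrite exprS -mulrA coef_geoM (big_cat_nat (n := t)) //= Z add0r.
rewrite size_power_wordsS Posz_sum [LHS](big_cat_nat (n := t)) //=.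
rewrite big1_seq ?add0r; last first.
  move=> a /andP[/andP[am]]; rewrite mem_index_iota => c /andP[_ at'].
  by move: c at'; rewrite -/q /t; lia.
rewrite big_seq_cond [RHS]big_seq_cond; apply: eq_big => a.
  rewrite mem_index_iota; case: (leqP t a) => //= ta; case: (leqP a m) => //= am.
  by rewrite -/q; congr (_ && _); move: ta; rewrite /t; lia.
rewrite mem_index_iota => /andP[_ /andP[am c]]; rewrite IH //.
by move: c; rewrite -/q; lia.
Qed.

(** The difference is a number of ballot words. *)
Lemma coef_geo_diff r D m : (0 < r)%N -> (2 * m.+1 <= (D * r.-1).+1)%N ->
  (geo r ^+ D)`_m <= (geo r ^+ D)`_m.+1.
Proof.
move=> r0 mD; rewrite -subr_ge0.
have := size_ballot_words r0 mD.
by rewrite mulrBr mulr1 coefB coefMX /= => <-.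
Qed.

Lemma coef_geo_ge0 r D m : 0 <= (geo r ^+ D)`_m.
Proof. by rewrite -size_power_words. Qed.

Lemma coef_geo_mono r D a b : (0 < r)%N -> (a <= b)%N -> (2 * b <= (D * r.-1).+1)%N ->
  (geo r ^+ D)`_a <= (geo r ^+ D)`_b.
Proof.
move=> r0; elim: b => [|b IH]; first by rewrite leqn0 => /eqP->.
rewrite leq_eqVlt => /orP[/eqP->//|ab] bD.
apply: le_trans (IH _ _) (coef_geo_diff r0 bD) => //; lia.
Qed.

(** Reflecting [b] in the middle [D (r - 1) / 2] if necessary brings both indices into
    the lower half, where the coefficients increase. *)
Lemma coef_geo_le r D a b : (0 < r)%N -> (a <= b)%N -> (a + b <= D * r.-1)%N ->
  (geo r ^+ D)`_a <= (geo r ^+ D)`_b.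
Proof.
move=> r0 ab abD; case: (leqP (2 * b) (D * r.-1)) => bD.
  by apply: coef_geo_mono => //; lia.
rewrite [leRHS]coef_geo_sym //; last by lia.
by apply: coef_geo_mono => //; lia.
Qed.

Lemma coef_geo_ge r D a b : (0 < r)%N -> (b <= a)%N -> (D * r.-1 <= a + b)%N ->
  (geo r ^+ D)`_a <= (geo r ^+ D)`_b.
Proof.
move=> r0 ab abD; case: (leqP a (D * r.-1)) => aD; last first.
  by rewrite coef_geo_out ?coef_geo_ge0.
rewrite (coef_geo_sym r0 aD) (coef_geo_sym (m := b) r0); last by lia.
by apply: coef_geo_le => //; lia.
Qed.

(** * Words in two groups of letters *)

Local Close Scope ring_scope.

(** The letters below [n] are the variables of [M] and the others, shifted by [n], those
    of [E]. The letters of [M] come first in a sorted word, which confines them to its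
    initial blocks. *)
Definition prod_word (n : nat) (M E : pred (seq nat)) (w : seq nat) : bool :=
  [&& sorted leq w, M [seq x <- w | x < n] & E [seq x - n | x <- w & n <= x]].

Definition prod_words (n : nat) (LM LE : nat -> seq (seq nat)) (m : nat) :=
  [seq p.1 ++ map (addn n) p.2 | j <- iota 0 m.+1,
     p <- [seq (u, v) | u <- LM j, v <- LE (m - j)]].

Section ProductWords.
Variables (n : nat) (M E : pred (seq nat)) (LM LE : nat -> seq (seq nat)).
Hypothesis M_lt : forall w, M w -> all (fun x => x < n) w.
Hypothesis M_sorted : forall w, M w -> sorted leq w.
Hypothesis E_sorted : forall w, E w -> sorted leq w.
Hypothesis LM_enum : enumerates LM M.
Hypothesis LE_enum : enumerates LE E.

Let filter_lt u v : all (fun x => x < n) u ->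
  [seq x <- u ++ map (addn n) v | x < n] = u.
Proof.
move=> un; rewrite filter_cat (all_filterP un) filter_map.
rewrite (eq_filter (a2 := pred0)) ?filter_pred0 ?cats0 // => x /=.
by rewrite ltnNge leq_addr.
Qed.

Let filter_ge u v : all (fun x => x < n) u ->
  [seq x - n | x <- u ++ map (addn n) v & n <= x] = v.
Proof.
move=> un; rewrite filter_cat (eq_in_filter (a2 := pred0)) ?filter_pred0 /=.
  rewrite filter_map (eq_filter (a2 := predT)) ?filter_predT.
    by rewrite -map_comp -[RHS]map_id; apply: eq_map => x /=; rewrite addKn.
  by move=> x /=; rewrite leq_addr.
by move=> x /(allP un) /=; rewrite ltnNge => /negbTE.
Qed.

Lemma prod_words_enum : enumerates (prod_words n LM LE) (prod_word n M E).
Proof.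
move=> m; split.
  apply: allpairs_uniq_dep; first exact: iota_uniq.
    move=> j _; apply: allpairs_uniq; rewrite ?(LM_enum j).1 ?(LE_enum _).1 //.
    by move=> [u v] [u' v'].
  move=> _ _ /allpairsPdep[j [p [_ + ->]]] /allpairsPdep[k [p' [_ + ->]]] /=.
  case/allpairsP=> [[u v]] [/= + _ ->]; rewrite (LM_enum _).2 => /andP[Mu /eqP su].
  case/allpairsP=> [[u' v']] [/= + _ ->]; rewrite (LM_enum _).2 => /andP[Mu' /eqP su'].
  move=> /= e; have uu : u = u'.
    by rewrite -[u](filter_lt v (M_lt Mu)) e filter_lt // M_lt.
  have vv : v = v'.
    by rewrite -[v](filter_ge v (M_lt Mu)) e filter_ge // M_lt.
  by rewrite uu vv -su -su' uu.
move=> w; apply/allpairsPdep/andP.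
  case=> j [p [+ + ->]]; rewrite mem_iota add0n ltnS => /andP[_ jm].
  case/allpairsP=> [[u v]] [/= + + ->] /=.
  rewrite (LM_enum _).2 (LE_enum _).2 => /andP[Mu /eqP su] /andP[Ev /eqP sv].
  split; last by rewrite size_cat size_map su sv subnKC.
  rewrite /prod_word filter_lt ?M_lt // filter_ge ?M_lt // Mu Ev !andbT.
  rewrite sorted_leq_cat M_sorted //=; apply/andP; split.
    apply/allrelP => x y /(allP (M_lt Mu)) /= xn /mapP[z _ ->].
    by apply: leq_trans (ltnW xn) (leq_addr _ _).
  rewrite sorted_map; apply: sub_sorted (E_sorted Ev) => x y /=.
  by rewrite leq_add2l.
case=> /and3P[sw Mw Ew] /eqP szw.
have e := sorted_leq_split n sw.
have e2 : map (addn n) [seq x - n | x <- w & n <= x] = [seq x <- w | n <= x].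
  rewrite -map_comp -[RHS]map_id; apply/eq_in_map => x.
  by rewrite mem_filter => /andP[nx _] /=; rewrite subnKC.
have szu : size [seq x <- w | x < n] <= m by rewrite -szw size_filter count_size.
exists (size [seq x <- w | x < n]).
exists ([seq x <- w | x < n], [seq x - n | x <- w & n <= x]); split.
- by rewrite mem_iota.
- apply/allpairsP; exists ([seq x <- w | x < n], [seq x - n | x <- w & n <= x]).
  split=> //=; first by rewrite (LM_enum _).2 Mw eqxx.
  rewrite (LE_enum _).2 Ew size_map /=; apply/eqP.
  by have := congr1 size e; rewrite size_cat szw => ->; rewrite addKn.
by rewrite /= e2 -e.
Qed.

Lemma size_prod_words m :
  size (prod_words n LM LE m) = \sum_(j < m.+1) size (LM j) * size (LE (m - j)).
Proof.
rewrite size_allpairs_dep sumnE big_map -[iota 0 m.+1]/(index_iota 0 m.+1) big_mkord.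
by apply: eq_bigr => j _; rewrite size_allpairs.
Qed.

Let filter_subseq2 (p : pred nat) u w :
  subseq u w -> subseq [seq x <- u | p x] [seq x <- w | p x].
Proof.
move=> uw; rewrite subseq_filter filter_all /=.
by apply: subseq_trans uw; apply: filter_subseq.
Qed.

Lemma prod_word_sorted w : prod_word n M E w -> sorted leq w.
Proof. by case/and3P. Qed.

Lemma prod_word_subseq u w :
  (forall u w, subseq u w -> M w -> M u) -> (forall u w, subseq u w -> E w -> E u) ->
  subseq u w -> prod_word n M E w -> prod_word n M E u.
Proof.
move=> Msub Esub uw /and3P[sw Mw Ew]; apply/and3P; split.
- exact: (subseq_sorted leq_trans uw).
- by apply: Msub Mw; apply: filter_subseq2.
by apply: Esub Ew; apply: map_subseq; apply: filter_subseq2.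
Qed.

(** A repeated block would be a power [x^r] of a single variable, so its square would
    be [x^(2r)]. *)
Lemma prod_word_square r u : 0 < r ->
  (forall w, M w -> size w < 2 * r) -> (forall w k, E w -> count_mem k w < r) ->
  size u = r -> ~~ prod_word n M E (u ++ u).
Proof.
move=> r0 Msz Ecnt su; apply/negP => /and3P[+ Mu Eu].
rewrite sorted_leq_cat => /and3P[/allrelP uu _ _].
case: u su uu Mu Eu => [|k u]; first by move=> /= su; rewrite -su in r0.
move=> su uu.
have -> : (k :: u) = nseq r k.
  rewrite -su; apply/all_pred1P/allP => x xu /=.
  by rewrite eqn_leq !uu ?mem_head.
case: (ltnP k n) => kn.
  move=> /Msz + _; rewrite -nseqD (all_filterP _) ?size_nseq; first by lia.
  by rewrite all_nseq kn orbT.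
move=> _ /(Ecnt _ (k - n)); rewrite -nseqD (all_filterP _); last by rewrite all_nseq kn orbT.
by rewrite map_nseq count_nseq /= eqxx; lia.
Qed.

End ProductWords.

(** In an increasing chain of blocks of length [r] the letter [k] can occur in two
    blocks only, because a block in between would be [k^r]. *)
Lemma count_flatten_chain r k (us : seq (seq nat)) : 0 < r ->
  all (fun u => size u == r) us -> sorted leq (flatten us) ->
  (forall u, u \in us -> count_mem k u < r) ->
  pairwise (fun u v => count_mem k (u ++ v) < r) us ->
  count_mem k (flatten us) < r.
Proof.
move=> r0; elim: us => [|u [|v us] IH] //=.
  by move=> _ _ /(_ u (mem_head _ _)); rewrite cats0.
move=> /and3P[su sv szs] ss cu /andP[/andP[cuv cus] pv].
case: (boolP (k \in u)) => ku; last first.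
  rewrite count_cat (count_memPn ku) add0n.
  apply: IH => //=; first by rewrite sv.
    by move: ss; rewrite sorted_leq_cat => /and3P[].
  by move=> x xv; apply: cu; rewrite inE xv orbT.
case: (boolP (k \in flatten us)) => kus; last first.
  by rewrite !count_cat (count_memPn kus) addn0 -count_cat.
have := cu v; rewrite !inE eqxx orbT => /(_ isT).
rewrite (_ : count_mem k v = r) ?ltnn // -(eqP sv); apply/eqP; rewrite -all_count.
move: ss; rewrite !sorted_leq_cat => /and3P[/allrelP uv _ /and3P[/allrelP vus _ _]].
apply/allP => x xv /=; rewrite eqn_leq vus // uv // mem_cat xv //.
Qed.

Lemma sorted_flatten_pairwise r (us : seq (seq nat)) : 0 < r ->
  all (fun u => (size u == r) && sorted leq u) us ->
  pairwise (fun u v => sorted leq (u ++ v)) us -> sorted leq (flatten us).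
Proof.
move=> r0; elim: us => //= u us IH /andP[/andP[_ su] sus] /andP[pu pus].
rewrite sorted_leq_cat su IH // !andbT; apply/allrelP => x y xu.
case/flattenP => v vus yv.
by have := allP pu v vus; rewrite sorted_leq_cat => /and3P[/allrelP H _ _]; apply: H.
Qed.

(** The letters of the first kind come first and there are fewer than [2 r] of them,
    so they all lie in the first two blocks. Each letter of the second kind meets at most
    two blocks as well. *)
Lemma prod_word_flatten n (M : pred (seq nat)) r D us : 0 < r -> M [::] ->
  (forall w, M w -> size w < 2 * r) ->
  let Q := prod_word n M (power_word false r D) in
  all (fun u => (size u == r) && Q u) us -> pairwise (fun u v => Q (u ++ v)) us ->
  Q (flatten us).
Proof.
move=> r0 M0 Msz Q aus pus.
have sus : sorted leq (flatten us).
  apply: (sorted_flatten_pairwise r0).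
    by apply: sub_all aus => u /andP[-> /and3P[]].
  by apply: sub_pairwise pus => u v /and3P[].
apply/and3P; split=> //.
  case: us aus pus sus => [|u [|v us]] //=.
    by rewrite cats0 => /andP[/andP[_ /and3P[]]].
  case/and3P=> /andP[/eqP su _] /andP[/eqP sv _] _ /andP[/andP[/and3P[_ Muv _] _] _].
  rewrite catA; case: (boolP (has (fun x => x < n) (flatten us))) => [|nh]; last first.
    rewrite !filter_cat -filter_cat.
    by move: nh; rewrite has_filter negbK => /eqP ->; rewrite cats0.
  case/hasP=> x xus xn; rewrite sorted_leq_cat => /and3P[/allrelP uvx _ _].
  have := Msz _ Muv; rewrite (all_filterP _); last first.
    by apply/allP => y yuv; apply: leq_ltn_trans xn; apply: uvx.
  by rewrite size_cat su sv; lia.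
rewrite /power_word; apply/and3P; split.
- rewrite sorted_map; apply: (@sub_sorted _ leq).
    by move=> x y /= xy; rewrite leq_sub2r.
  exact: (sorted_filter leq_trans).
- apply/allP => _ /mapP[x + ->]; rewrite mem_filter => /andP[nx /flattenP[u uus xu]].
  have /andP[_ /and3P[_ _ /and3P[_ + _]]] := allP aus u uus.
  by move/allP; apply; apply: map_f; rewrite mem_filter nx.
apply/allP => k _; rewrite andbT.
have cE w : count_mem k [seq x - n | x <- w & n <= x] = count_mem (n + k) w.
  rewrite count_map count_filter; apply: eq_count => x /=.
  by case: (leqP n x) => nx; apply/idP/idP; lia.
rewrite cE; apply: (count_flatten_chain r0) => //.
- by apply: sub_all aus => u /andP[].
- move=> u /(allP aus) /andP[_ /and3P[_ _ Eu]]; rewrite -cE.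
  exact: power_word_count Eu.
apply: sub_pairwise pus => u v /and3P[_ _ Euv]; rewrite -cE.
exact: power_word_count Euv.
Qed.

(** * f-polynomials of block complexes *)

Lemma size_enum0 L Q : enumerates L Q -> Q [::] -> size (L 0) = 1.
Proof.
move=> LQ Q0; rewrite (@perm_size _ (L 0) [:: [::]]) //.
apply: uniq_perm; rewrite ?(LQ 0).1 // => w; rewrite (LQ 0).2 inE.
by case: w => [|x w]; rewrite ?Q0 ?andbF.
Qed.

Local Open Scope ring_scope.

Section FPoly.
Variables (r : nat) (Q : pred (seq nat)) (L : nat -> seq (seq nat)).
Hypothesis r_gt0 : (0 < r)%N.
Hypothesis Q_sorted : forall w, Q w -> sorted leq w.
Hypothesis Q_subseq : forall u w, subseq u w -> Q w -> Q u.
Hypothesis Q_square : forall u, size u = r -> ~~ Q (u ++ u).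
Hypothesis L_enum : enumerates L Q.
Hypothesis Q_nil : Q [::].

(** A face with [i] elements needs [i] different blocks. *)
Lemma enum_block_out i : (size (L r) < i)%N -> size (L (i * r)) = 0%N.
Proof.
move=> Ni; rewrite -(card_block_complex r_gt0 Q_sorted Q_subseq Q_square L_enum (leqnn i)).
apply: eq_card0 => F; rewrite !inE; apply/negbTE; rewrite negb_and; apply/orP; right.
by rewrite neq_ltn (leq_ltn_trans (max_card _)) ?card_ord.
Qed.

Lemma fpoly_block_complex (b : nat) (f : {poly int}) :
  (forall i, f`_i = if (i <= b)%N then (size (L (i * r)))%:Z else 0) ->
  f = fpoly (block_complex r Q L b).
Proof.
move=> fE; apply/polyP => i; rewrite coef_poly fE ltnS.
case: (leqP i (size (L r))) => iN; last by rewrite enum_block_out // if_same.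
case: eqP => [->|_]; first by rewrite mul0n (size_enum0 L_enum).
case: leqP => ib; first by rewrite card_block_complex.
rewrite (_ : #|_| = 0%N) //; apply: eq_card0 => F; rewrite !inE; apply/negbTE/negP.
case/andP=> /asboolP[ts [uts Fts szts _]] /eqP cF.
move: ib; rewrite -cF ltnNge (leq_trans _ szts) // -(card_uniqP uts).
by rewrite (eq_card Fts).
Qed.

End FPoly.

Lemma coefM_le_size (h p : {poly int}) m :
  (h * p)`_m = \sum_(j < size h) (if (j <= m)%N then h`_j * p`_(m - j) else 0).
Proof.
rewrite -{1}[h]coefK poly_def mulr_suml coef_sum; apply: eq_bigr => j _.
by rewrite -scalerAl coefZ coefXnM ltnNge; case: leqP => _ //=; rewrite mulr0.
Qed.

(** * Inequalities between the coefficients of the Veronese h-polynomial *)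

Section VeroneseInequalities.
Variables (r d : nat) (h hV : {poly int}).
Hypothesis r_gt0 : (0 < r)%N.
Hypothesis h_ge0 : forall j, 0 <= h`_j.
Hypothesis hVE : forall i, hV`_i = (h * geo r ^+ d)`_(i * r).

Let hV_ge0 i : 0 <= hV`_i.
Proof.
rewrite hVE coefM; apply: sumr_ge0 => j _; apply: mulr_ge0 => //.
exact: coef_geo_ge0.
Qed.

(** Both coefficients are sums over the coefficients [h_k]; the hypothesis says that
    in each term the index into [geo r ^+ d] moves towards the middle. *)
Let hV_le i j : (i <= j)%N ->
  (forall k, k <= deg h -> k <= i * r -> i * r - k + (j * r - k) <= d * r.-1)%N ->
  hV`_i <= hV`_j.
Proof.
move=> ij H; rewrite !hVE !coefM_le_size; apply: ler_sum => k _.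
case: leqP => ki; last by case: ifP => // _; rewrite mulr_ge0 ?coef_geo_ge0.
have irjr : (i * r <= j * r)%N by rewrite leq_mul2r ij orbT.
rewrite (leq_trans ki) // ler_wpM2l //.
apply: coef_geo_le => //; first by rewrite leq_sub2r.
by apply: H => //; have := ltn_ord k; rewrite /deg; lia.
Qed.

Let hV_ge i j : (i <= j)%N ->
  (forall k, k <= deg h -> k <= i * r /\ d * r.-1 <= i * r - k + (j * r - k))%N ->
  hV`_j <= hV`_i.
Proof.
move=> ij H; rewrite !hVE !coefM_le_size; apply: ler_sum => k _.
have [|ki kd] := H k; first by have := ltn_ord k; rewrite /deg; lia.
have irjr : (i * r <= j * r)%N by rewrite leq_mul2r ij orbT.
rewrite ki (leq_trans ki) // ler_wpM2l //.
by apply: coef_geo_ge; rewrite ?leq_sub2r // addnC.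
Qed.

Lemma veronese_half_symm i : (2 * i <= ((r - 1) * d) %/ r)%N ->
  hV`_i <= hV`_(((r - 1) * d) %/ r - i).
Proof.
set s := (_ %/ r)%N => i2s.
have sr : (s * r <= d * r.-1)%N by rewrite -subn1 [leqRHS]mulnC leq_divM.
have irs : (i * r + (s - i) * r = s * r)%N by rewrite -mulnDl subnKC //; lia.
by apply: hV_le => [|k _ _]; lia.
Qed.

(** The coefficients increase up to the least [p] with [(2 p + 1) r > d (r - 1)] and
    decrease from [p + 1] on; the step in between can go either way. *)
Lemma veronese_unimodal : (deg h <= r)%N -> unimodal hV.
Proof.
move=> hr; split=> //; pose p := ((d * r.-1 + r) %/ (2 * r))%N.
have pE i : (i < p)%N = (i.+1 * (2 * r) <= d * r.-1 + r)%N.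
  by rewrite /p leq_divRL // muln_gt0.
have up i : (i < p)%N -> hV`_i <= hV`_i.+1.
  by rewrite pE => ip; apply: hV_le => // k _ _; move: ip; rewrite !mulSn; lia.
have down i : (p < i)%N -> hV`_i.+1 <= hV`_i.
  case: i => // i; rewrite ltnS leqNgt pE -ltnNge => ip; apply: hV_ge => // k kd.
  by move: ip; rewrite !mulSn; lia.
pose p' := if hV`_p <= hV`_p.+1 then p.+1 else p.
have up' i : (i < p')%N -> hV`_i <= hV`_i.+1.
  rewrite /p'; case: ifP => [pp|_]; last exact: up.
  by rewrite ltnS leq_eqVlt => /orP[/eqP->//|/up].
have down' i : (p' <= i)%N -> hV`_i.+1 <= hV`_i.
  rewrite /p'; case: leP => [_|pp]; first exact: down.
  by rewrite leq_eqVlt => /orP[/eqP<-|/down //]; apply: ltW.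
exists (minn p' (deg hV)); split; first exact: geq_minr.
  by move=> i; rewrite leq_min => /andP[/up'].
by move=> i; rewrite geq_min => /orP[/down'//|di]; rewrite ltnNge di.
Qed.

Lemma veronese_deg : h`_0 != 0 -> (deg hV * r <= d * r.-1 + deg h)%N.
Proof.
move=> h0.
have hV0 : hV`_0 = h`_0 by rewrite hVE mul0n coef0M coef_geo0 ?mulr1.
have hV_neq0 : hV != 0 by apply: contraNneq h0 => hV0'; rewrite -hV0 hV0' coef0.
have : hV`_(deg hV) != 0 by rewrite -lead_coefE lead_coef_eq0.
rewrite hVE; apply: contraR; rewrite -ltnNge => lt; apply/eqP/nth_default.
apply: leq_trans (size_polyMleq _ _) _.
by have := size_geo d r_gt0; move: lt; rewrite /deg; lia.
Qed.

End VeroneseInequalities.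

(** * The complexes of a Veronese h-polynomial *)

Section VeroneseComplexes.
Variables (n : nat) (M : pred (seq nat)) (LM : nat -> seq (seq nat)).
Variables (r d : nat) (h hV : {poly int}).
Hypothesis M_lt : forall w, M w -> all (fun x => (x < n)%N) w.
Hypothesis M_sorted : forall w, M w -> sorted leq w.
Hypothesis M_subseq : forall u w, subseq u w -> M w -> M u.
Hypothesis M_nil : M [::].
Hypothesis LM_enum : enumerates LM M.
Hypothesis r_gt0 : (0 < r)%N.
Hypothesis hE : forall j, h`_j = (size (LM j))%:Z.
Hypothesis hVE : forall i, hV`_i = (h * geo r ^+ d)`_(i * r).

Let M_size w : M w -> (size w <= deg h)%N.
Proof.
move=> Mw; rewrite /deg; have: h`_(size w) != 0.
  rewrite hE; have: w \in LM (size w) by rewrite (LM_enum _).2 Mw eqxx.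
  by case: (LM _).
apply: contraR; rewrite -ltnNge => lt; apply/eqP/nth_default.
by apply: leq_trans lt; apply: leqSpred.
Qed.

Let size_power_prod m :
  (size (prod_words n LM (power_words false r d) m))%:Z = (h * geo r ^+ d)`_m.
Proof.
rewrite size_prod_words Posz_sum coefM; apply: eq_bigr => j _.
by rewrite PoszM hE size_power_words.
Qed.

Let size_ballot_prod m : (2 * m <= (d.+1 * r.-1).+1)%N ->
  (size (prod_words n LM (power_words true r d.+1) m))%:Z
    = (h * (geo r ^+ d.+1 * (1 - 'X)))`_m.
Proof.
move=> md; rewrite size_prod_words Posz_sum coefM; apply: eq_bigr => j _.
by rewrite PoszM hE size_ballot_words //; lia.
Qed.

Let power_nil b D : power_word b r D [::].
Proof.
by rewrite /power_word /=; apply/allP => k _; rewrite r_gt0 implybT.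
Qed.

Let power_sorted b D w : power_word b r D w -> sorted leq w.
Proof. by case/and3P. Qed.

Lemma veronese_flag : ((deg h).+1 <= 2 * r)%N -> is_flag_fpoly hV.
Proof.
move=> hr; have Msz w : M w -> (size w < 2 * r)%N by move/M_size; lia.
set Q := prod_word n M (power_word false r d).
set LQ := prod_words n LM (power_words false r d).
have LQ_enum : enumerates LQ Q.
  exact: (prod_words_enum M_lt M_sorted (@power_sorted _ _) LM_enum (power_words_enum _ _ _)).
have Qsub : forall u w, subseq u w -> Q w -> Q u.
  move=> u w; apply: (prod_word_subseq M_subseq); exact: power_word_subseq.
have Qsq : forall u, size u = r -> ~~ Q (u ++ u).
  move=> u; apply: (prod_word_square n r_gt0 Msz) => w k; exact: power_word_count.
exists (size (LQ r)), (block_complex r Q LQ (size (LQ r))); split.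
- exact: block_complex_simplicial.
- apply: block_complex_flag => //.
    by move=> w; apply: prod_word_sorted.
  by move=> us; apply: (prod_word_flatten r_gt0 M_nil Msz).
apply: fpoly_block_complex => //.
- by move=> w; apply: prod_word_sorted.
- by rewrite /Q /prod_word /= M_nil power_nil.
move=> i; rewrite hVE -size_power_prod -/LQ; case: leqP => // iN.
rewrite (enum_block_out r_gt0 _ Qsub Qsq LQ_enum) // => w.
exact: prod_word_sorted.
Qed.

(** Here [d + 1] variables come from the factor [1 - t^r = (1 - t) (1 + ... + t^(r-1))]
    that turns coefficients into differences. The degree bound keeps the difference in
    the range where ballot words count it. *)
Lemma veronese_gpoly : (deg h <= r)%N -> is_fpoly (gpoly hV).
Proof.
move=> hr.
have deg_hV : (deg hV * r <= d * r.-1 + deg h)%N.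
  by apply: (veronese_deg r_gt0 hVE); rewrite hE (size_enum0 LM_enum).
have Msz w : M w -> (size w < 2 * r)%N by move/M_size; lia.
set Q := prod_word n M (power_word true r d.+1).
set LQ := prod_words n LM (power_words true r d.+1).
have LQ_enum : enumerates LQ Q.
  exact: (prod_words_enum M_lt M_sorted (@power_sorted _ _) LM_enum (power_words_enum _ _ _)).
have Qsub : forall u w, subseq u w -> Q w -> Q u.
  move=> u w; apply: (prod_word_subseq M_subseq); exact: power_word_subseq.
have Qsq : forall u, size u = r -> ~~ Q (u ++ u).
  move=> u; apply: (prod_word_square n r_gt0 Msz) => w k; exact: power_word_count.
have Q0 : Q [::] by rewrite /Q /prod_word /= M_nil power_nil.
exists (size (LQ r)), (block_complex r Q LQ (deg hV)./2); split.
  exact: block_complex_simplicial.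
apply: fpoly_block_complex => //.
  by move=> w; apply: prod_word_sorted.
move=> i; rewrite coef_poly ltnS; case: leqP => // ib.
case: i ib => [|i] ib.
  rewrite hVE !mul0n coef0M coef_geo0 // mulr1 hE.
  by rewrite (size_enum0 LM_enum) // (size_enum0 LQ_enum).
have ird : (2 * (i.+1 * r) <= (d.+1 * r.-1).+1)%N.
  have : (i.+1 * 2 * r <= deg hV * r)%N.
    by rewrite leq_mul2r; apply/orP; right; lia.
  by rewrite mulSn; move: deg_hV r_gt0 hr; lia.
rewrite size_ballot_prod // exprSr -mulrA geo_mul1X mulrA mulrBr mulr1 coefB coefMXn.
by rewrite ltnNge mulSn leq_addr /= addKn !hVE.
Qed.

End VeroneseComplexes.

(** * Ideals, prime ideals and homogeneous components *)

Section Ideals.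
Variable R : comNzRingType.
Implicit Types (I : R -> Prop) (x y a : R).

Definition ideal I := I 0 /\ forall a x y, I x -> I y -> I (a * x + y).

Definition adjoin I x : R -> Prop := fun y => exists a, I (y - a * x).

Definition regular_mod I x := forall y, I (x * y) -> I y.

(** The recursion enlarges the base ideal instead of the initial segment, so that
    inductions on [s] generalise over [I]. *)
Fixpoint regular_from I (s : seq R) : Prop :=
  if s is x :: s' then regular_mod I x /\ regular_from (adjoin I x) s' else True.

Definition zero_ideal : R -> Prop := fun x => x = 0.

Lemma ideal_zero : ideal zero_ideal.
Proof. by split=> // a x y -> ->; rewrite mulr0 addr0. Qed.

Section Closure.
Variables (I : R -> Prop) (iI : ideal I).

Lemma ideal0 : I 0. Proof. by case: iI. Qed.

Lemma idealD x y : I x -> I y -> I (x + y).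
Proof. by move=> Ix Iy; rewrite -[x]mul1r; apply: iI.2. Qed.

Lemma idealMl a x : I x -> I (a * x).
Proof. by move=> Ix; rewrite -[_ * _]addr0; apply: iI.2 => //; apply: ideal0. Qed.

Lemma idealN x : I x -> I (- x).
Proof. by rewrite -mulN1r; apply: idealMl. Qed.

Lemma idealB x y : I x -> I y -> I (x - y).
Proof. by move=> Ix /idealN; apply: idealD. Qed.

Lemma ideal_sum (T : Type) (s : seq T) (P : pred T) (F : T -> R) :
  (forall i, P i -> I (F i)) -> I (\sum_(i <- s | P i) F i).
Proof. by move=> IF; apply: big_ind => //; [apply: ideal0 | apply: idealD]. Qed.

Lemma ideal_trans x y : I y -> I (x - y) -> I x.
Proof. by move=> Iy Ixy; rewrite -[x](subrK y); apply: idealD. Qed.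

Lemma ideal_adjoin x : ideal (adjoin I x).
Proof.
split; first by exists 0; rewrite mul0r subr0; apply: ideal0.
move=> a y z [b Ib] [c Ic]; exists (a * b + c).
by rewrite (_ : _ - _ = a * (y - b * x) + (z - c * x)); [apply: iI.2 | ring].
Qed.

Lemma sub_adjoin x y : I y -> adjoin I x y.
Proof. by exists 0; rewrite mul0r subr0. Qed.

Lemma mem_adjoin x : adjoin I x x.
Proof. by exists 1; rewrite mul1r subrr; apply: ideal0. Qed.

End Closure.

Lemma ideal_prime (P : {pred R}) : prime_ideal P -> ideal (fun x => x \in P).
Proof. by case=> -[P0 _ PL] _; split=> // a x y; apply: PL. Qed.

(** By Zorn's lemma there is an ideal maximal among those that contain [I] and miss [S],
    and such an ideal is prime. The last clause, which is its maximality, is what lying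
    over needs. *)
Lemma exists_prime_avoiding (I S : R -> Prop) : ideal I ->
  S 1 -> (forall x y, S x -> S y -> S (x * y)) -> (forall x, I x -> ~ S x) ->
  exists P : {pred R}, [/\ prime_ideal P, forall x, I x -> x \in P,
    forall x, S x -> x \notin P
    & forall x, x \notin P -> exists s a, S s /\ s - a * x \in P].
Proof.
move=> iI S1 SM IS.
pose good (J : R -> Prop) :=
  ideal (fun x => I x \/ J x) /\ (forall x, J x -> ~ S x).
have [|J [[iJ JS] Jmax]] := @classical_sets.Zorn_bigcup R good.
  move=> F Fgood Ftot; split; last first.
    by move=> x [J FJ Jx]; apply: (Fgood _ FJ).2.
  split; first by left; apply: ideal0.
  move=> a x y Ix Iy.
  have [[Ix' Iy']|[J [FJ Jx Jy]]] : (I x /\ I y) \/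
      exists J, [/\ F J, I x \/ J x & I y \/ J y].
    case: Ix Iy => [Ix|[J1 FJ1 Jx]] [Iy|[J2 FJ2 Jy]].
    - by left.
    - by right; exists J2; split; [|left|right].
    - by right; exists J1; split; [|right|left].
    right; case: (Ftot J1 J2 FJ1 FJ2) => sub.
      by exists J2; split=> //; right=> //; apply: sub.
    by exists J1; split=> //; right=> //; apply: sub.
    by left; apply: iI.2.
  have [_ /(_ a x y Jx Jy)] := (Fgood J FJ).1.
  by case=> [?|Jz]; [left | right; exists J].
pose Q x := I x \/ J x.
have QS x : Q x -> ~ S x by case=> [/IS|/JS].
have Qmax x : ~ Q x -> exists s a, S s /\ Q (s - a * x).
  move=> nQx; apply: contrapT => H.
  apply: (Jmax (adjoin Q x)).
    split; first by move=> y Jy; apply: sub_adjoin; right.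
    by move=> sub; apply: nQx; right; apply: sub; apply: mem_adjoin.
  have iQx := ideal_adjoin iJ x.
  split; last by move=> s [a Qs] Ss; apply: H; exists s, a.
  rewrite (_ : (fun y => _) = adjoin Q x) //; apply: funext => y.
  apply: propext; split=> [[Iy|//]|]; last by right.
  by apply: sub_adjoin; left.
exists (fun x => `[< Q x >]).
have memQ x : (x \in (fun x => `[< Q x >])) = `[< Q x >] by [].
split.
- split.
    split; first by rewrite memQ; apply/asboolP/(ideal0 iJ).
      by rewrite memQ; apply/asboolP => /QS; apply.
    by move=> a x y; rewrite !memQ => /asboolP Qx /asboolP Qy; apply/asboolP/iJ.2.
  move=> x y; rewrite !memQ => /asboolP Qxy.
  apply/orP; rewrite -[_ \/ _]/((_ : Prop) \/ _).
  case: (pselect (Q x)) => [Qx|nx]; first by left; apply/asboolP.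
  case: (pselect (Q y)) => [Qy|ny]; first by right; apply/asboolP.
  have [s [a [Ss Qs]]] := Qmax _ nx; have [t [b [St Qt]]] := Qmax _ ny.
  case: (QS (s * t)); last exact: SM.
  rewrite (_ : s * t = t * (s - a * x) + (a * x * (t - b * y) + a * b * (x * y))).
    by apply: iJ.2 => //; apply: iJ.2 => //; apply: (idealMl iJ).
  by ring.
- by move=> x Ix; rewrite memQ; apply/asboolP; left.
- by move=> x Sx; rewrite memQ; apply/asboolP => /QS.
by move=> x; rewrite memQ => /asboolP /Qmax [s [a [Ss Qs]]]; exists s, a; rewrite memQ;
  split=> //; apply/asboolP.
Qed.

End Ideals.

Section Components.
Variables (K : fieldType) (A : comAlgType K) (G : standard_grading A).
Implicit Types (x y : A) (i j : nat).

Lemma componentZ i (a : K) x : x \in G i -> a *: x \in G i.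
Proof. by move=> Gx; rewrite -[_ *: _]addr0; apply: component_lin => //; apply: component_0. Qed.

Lemma componentD i x y : x \in G i -> y \in G i -> x + y \in G i.
Proof. by move=> Gx Gy; rewrite -[x]scale1r; apply: component_lin. Qed.

Lemma componentB i x y : x \in G i -> y \in G i -> x - y \in G i.
Proof. by move=> Gx Gy; rewrite addrC -scaleN1r; apply: component_lin. Qed.

Lemma component_sum i (T : Type) (s : seq T) (P : pred T) (F : T -> A) :
  (forall k, P k -> F k \in G i) -> \sum_(k <- s | P k) F k \in G i.
Proof.
by move=> H; apply: (big_ind (fun x => x \in G i)) => //;
  [apply: component_0 | move=> x y; apply: componentD].
Qed.

Lemma component_1 : (1 : A) \in G 0.
Proof. by apply/component0; exists 1; rewrite scale1r. Qed.

Lemma componentX i x n : x \in G i -> x ^+ n \in G (n * i)%N.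
Proof.
move=> Gx; elim: n => [|n IH]; first by rewrite expr0; apply: component_1.
by rewrite exprS mulSn; apply: component_mul.
Qed.

Definition decomposition x (c : nat -> A) (N : nat) :=
  [/\ forall i, c i \in G i, forall i, (N <= i)%N -> c i = 0 & x = \sum_(i < N) c i].

Lemma decomposition_widen x c N N' :
  (N <= N')%N -> decomposition x c N -> decomposition x c N'.
Proof.
move=> NN' [Gc c0 xE]; split=> // [i N'i|]; first by apply: c0; apply: leq_trans N'i.
rewrite xE (big_ord_widen _ c NN') big_mkcond; apply: eq_bigr => i _.
by case: ltnP => // /c0.
Qed.

Lemma decomposition_uniq x c N c' N' :
  decomposition x c N -> decomposition x c' N' -> c =1 c'.
Proof.
move=> D D' i; pose m := (maxn (maxn N N') i.+1).
have [] := decomposition_widen (_ : N <= m)%N D; first by rewrite /m; lia.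
move=> Gc c0 xc.
have [] := decomposition_widen (_ : N' <= m)%N D'; first by rewrite /m; lia.
move=> Gc' c0' xc'; apply/eqP; rewrite -subr_eq0; apply/eqP.
apply: (@component_direct _ _ G m (fun i => c i - c' i)).
- by move=> j; apply: componentB.
- by rewrite sumrB -xc -xc' subrr.
by rewrite /m; lia.
Qed.

Lemma decomposition_exists x : exists c N, decomposition x c N.
Proof.
have [N [c [Gc xE]]] := component_span G x.
exists (fun i => if (i < N)%N then c i else 0), N; split.
- by move=> i; case: ifP => // _; apply: component_0.
- by move=> i; rewrite ltnNge => ->.
by rewrite xE; apply: eq_bigr => i _; rewrite ltn_ord.
Qed.

Definition hcomp x : nat -> A := projT1 (cid (decomposition_exists x)).

Lemma hcomp_decomposition x : exists N, decomposition x (hcomp x) N.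
Proof. exact: projT2 (cid (decomposition_exists x)). Qed.

Lemma hcompE x c N : decomposition x c N -> hcomp x =1 c.
Proof. by have [N' D'] := hcomp_decomposition x; apply: decomposition_uniq D'. Qed.

Lemma hcomp_in x i : hcomp x i \in G i.
Proof. by have [N []] := hcomp_decomposition x. Qed.

Lemma hcomp_lin (a : K) x y i : hcomp (a *: x + y) i = a *: hcomp x i + hcomp y i.
Proof.
have [N D] := hcomp_decomposition x; have [N' D'] := hcomp_decomposition y.
have := decomposition_widen (leq_maxl N N') D.
have := decomposition_widen (leq_maxr N N') D'.
move=> [Gy y0 yE] [Gx x0 xE].
apply: (@hcompE _ (fun i => a *: hcomp x i + hcomp y i) (maxn N N')); split.
- by move=> j; apply: component_lin.
- by move=> j Nj; rewrite x0 // y0 // scaler0 addr0.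
by rewrite big_split /= -scaler_sumr -xE -yE.
Qed.

Lemma hcomp0 i : hcomp 0 i = 0.
Proof.
apply: (@hcompE _ (fun=> 0) 0); split=> //; last by rewrite big_ord0.
by move=> j; apply: component_0.
Qed.

Lemma hcompZ (a : K) x i : hcomp (a *: x) i = a *: hcomp x i.
Proof. by rewrite -[_ *: x]addr0 hcomp_lin hcomp0 addr0. Qed.

Lemma hcompD x y i : hcomp (x + y) i = hcomp x i + hcomp y i.
Proof. by rewrite -[x]scale1r hcomp_lin !scale1r. Qed.

Lemma hcompB x y i : hcomp (x - y) i = hcomp x i - hcomp y i.
Proof. by rewrite -scaleN1r hcompD hcompZ scaleN1r. Qed.

Lemma hcomp_hom x i j : x \in G j -> hcomp x i = if i == j then x else 0.
Proof.
move=> Gx; apply: (@hcompE _ (fun i => if i == j then x else 0) j.+1); split.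
- by move=> k; case: eqP => [->|_] //; apply: component_0.
- by move=> k jk; case: eqP => // kj; rewrite kj ltnn in jk.
rewrite (bigD1 ord_max) //= eqxx big1 ?addr0 // => k.
by rewrite -val_eqE /= => /negPf ->.
Qed.

Lemma hcompM x y i j : x \in G j ->
  hcomp (y * x) i = if (j <= i)%N then hcomp y (i - j) * x else 0.
Proof.
move=> Gx; have [N [Gy y0 yE]] := hcomp_decomposition y.
apply: (@hcompE _ (fun i => if (j <= i)%N then hcomp y (i - j) * x else 0) (j + N)); split.
- move=> k; case: leqP => jk; last exact: component_0.
  by rewrite -{2}(subnK jk); apply: component_mul.
- by move=> k Nk; case: leqP => // jk; rewrite y0 ?mul0r //; lia.
rewrite big_split_ord /= big1 ?add0r; last by move=> k _; rewrite leqNgt ltn_ord.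
rewrite [in LHS]yE mulr_suml; apply: eq_bigr => k _.
by rewrite leq_addr addKn.
Qed.

Lemma hcomp_sum (T : Type) (s : seq T) (P : pred T) (F : T -> A) i :
  hcomp (\sum_(k <- s | P k) F k) i = \sum_(k <- s | P k) hcomp (F k) i.
Proof.
by apply: (big_morph (fun x => hcomp x i)); [move=> x y; apply: hcompD | apply: hcomp0].
Qed.

Definition homogeneous (I : A -> Prop) := forall x i, I x -> I (hcomp x i).

Lemma homogeneous_zero : homogeneous (@zero_ideal A).
Proof. by move=> x i ->; apply: hcomp0. Qed.

Lemma homogeneous_adjoin I x j : ideal I -> homogeneous I -> x \in G j ->
  homogeneous (adjoin I x).
Proof.
move=> iI hI Gx y i [a Ia]; have := hI _ i Ia; rewrite hcompB (hcompM _ _ Gx).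
by case: leqP => _; [exists (hcomp a (i - j)) | rewrite subr0; apply: sub_adjoin].
Qed.

(** The component of degree [i] of the relation [y = a x] modulo [I] is a relation with
    a homogeneous coefficient. *)
Lemma adjoin_hom I x y i j : ideal I -> homogeneous I -> x \in G j ->
  y \in G i -> adjoin I x y ->
  if (j <= i)%N then exists2 a, a \in G (i - j)%N & I (y - a * x) else I y.
Proof.
move=> iI hI Gx Gy [a Ia]; have := hI _ i Ia; rewrite hcompB (hcompM _ _ Gx).
rewrite (hcomp_hom i Gy) eqxx; case: leqP => _; last by rewrite subr0.
by exists (hcomp a (i - j)) => //; apply: hcomp_in.
Qed.

End Components.

(** * Regular sequences and monomials *)

Section RegularSequences.
Variable R : comNzRingType.
Implicit Types (I : R -> Prop) (x y : R) (s : seq R).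

Fixpoint adjoins I s : R -> Prop := if s is x :: s' then adjoins (adjoin I x) s' else I.

Lemma adjoins_rcons I s x : adjoins I (rcons s x) = adjoin (adjoins I s) x.
Proof. by elim: s I => //= y s IH I; apply: IH. Qed.

Lemma ideal_adjoins I s : ideal I -> ideal (adjoins I s).
Proof. by elim: s I => //= x s IH I iI; apply: IH; apply: ideal_adjoin. Qed.

Lemma adjoinsP I s y : ideal I ->
  adjoins I s y <-> exists c : nat -> R, I (y - \sum_(i < size s) c i * s`_i).
Proof.
elim: s I => [|x s IH] I iI /=.
  split=> [Iy|[c]]; last by rewrite big_ord0 subr0.
  by exists (fun=> 0); rewrite big_ord0 subr0.
rewrite IH; last exact: ideal_adjoin.
split=> [[c [a Ic]]|[c Ic]].
  exists (fun i => if i is j.+1 then c j else a).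
  by rewrite big_ord_recl /= opprD addrA addrAC.
exists (fun i => c i.+1), (c 0%N); move: Ic.
by rewrite big_ord_recl /= opprD addrA addrAC.
Qed.

Lemma in_idealP s y : in_ideal s y <-> adjoins (@zero_ideal R) s y.
Proof.
rewrite adjoinsP; last exact: ideal_zero.
split=> [[c ->]|[c]]; exists c; first by rewrite subrr.
by apply/eqP; rewrite -subr_eq0; apply/eqP.
Qed.

Lemma regular_fromP I s : regular_from I s <->
  forall i, (i < size s)%N -> forall y,
    adjoins I (take i s) (s`_i * y) -> adjoins I (take i s) y.
Proof.
elim: s I => [|x s IH] I /=; first by split.
rewrite IH; split=> [[Ix H] [|i] //= si|H]; first exact: H.
split; first exact: (H 0%N).
by move=> i si; apply: (H i.+1).
Qed.

Lemma regular_seq_from s : regular_seq s -> regular_from (@zero_ideal R) s.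
Proof.
case=> _ H; apply/regular_fromP => i si y /in_idealP Hy.
by apply/in_idealP; apply: H.
Qed.

Lemma regular_from_rcons I s x :
  regular_from I (rcons s x) <-> regular_from I s /\ regular_mod (adjoins I s) x.
Proof.
elim: s I => [|y s IH] I /=; first by split=> [[]|[]].
by rewrite IH; split=> [[? []]|[[]]].
Qed.

Lemma adjoin_comm I x y : ideal I -> adjoin (adjoin I x) y = adjoin (adjoin I y) x.
Proof.
move=> iI; apply: funext => z; apply: propext.
by split=> -[a [b H]]; exists b, a; move: H; congr I; ring.
Qed.

Lemma ideal_expB I x y n : ideal I -> I (x - y) -> I (x ^+ n - y ^+ n).
Proof. by move=> iI Ixy; rewrite subrXX mulrC; apply: idealMl. Qed.

(** The elements [t x^k] with [t] outside [P] avoid [I], since [x] is a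
    non-zero-divisor modulo [I]; a prime that contains [I] and avoids them is smaller
    than [P]. *)
Lemma prime_descent I (P : {pred R}) x : ideal I -> prime_ideal P ->
  (forall y, I y -> y \in P) -> x \in P -> regular_mod I x ->
  exists P' : {pred R}, [/\ prime_ideal P', forall y, I y -> y \in P',
    {subset P' <= P} & x \notin P'].
Proof.
move=> iI [iP pP] IP Px rx.
pose S y := exists t k, t \notin P /\ y = t * x ^+ k.
have [||y Iy [t [k [Pt yE]]]|P' [pP' IP' SP' _]] := @exists_prime_avoiding _ I S iI.
- by exists 1, 0%N; rewrite mulr1; split=> //; case: iP.
- move=> _ _ [t [k [Pt ->]]] [u [l [Pu ->]]]; exists (t * u), (k + l)%N.
  split; last by rewrite exprD mulrACA.
  by apply/negP => /pP; rewrite (negbTE Pt) (negbTE Pu).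
- case/negP: Pt; apply: IP; move: Iy; rewrite {y}yE.
  elim: k => [|k IH]; first by rewrite mulr1.
  by rewrite exprS mulrCA => /rx.
exists P'; split=> // [y|].
  apply: contraLR => Py; apply: SP'; exists y, 0%N; by rewrite mulr1.
by apply: SP'; exists 1, 1%N; rewrite mul1r; split=> //; case: iP.
Qed.

(** Each element of the sequence gives one descent, the last element the first one. *)
Lemma prime_chain_below I s (P : {pred R}) : ideal I -> regular_from I s ->
  prime_ideal P -> (forall y, adjoins I s y -> y \in P) ->
  exists c : nat -> {pred R},
    [/\ prime_chain (size s) c, forall y, I y -> y \in c 0%N & c (size s) = P].
Proof.
elim: s I => [|x s IH] I iI /=.
  by move=> _ pP IP; exists (fun=> P); split=> //; split.
move=> [rx rs] pP sP.
have [c [[pc lc] c0 cs]] := IH _ (ideal_adjoin iI x) rs pP sP.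
have [|||P' [pP' IP' sP' xP']] := @prime_descent I (c 0%N) x iI _ _ _ rx.
- exact: pc.
- by move=> y Iy; apply: c0; apply: sub_adjoin.
- by apply: c0; apply: mem_adjoin.
exists (fun i => if i is j.+1 then c j else P'); split=> //; split.
  by case=> [|i] //; rewrite ltnS; apply: pc.
case=> [|i]; last by rewrite ltnS; apply: lc.
by split=> //; exists x => //; apply: c0; apply: mem_adjoin.
Qed.

End RegularSequences.

Section Monomials.
Variables (K : fieldType) (A : comAlgType K) (G : standard_grading A).
Implicit Types (x y : A) (I : A -> Prop).

Lemma idealZ I (a : K) x : ideal I -> I x -> I (a *: x).
Proof. by move=> iI Ix; rewrite -mulr_algl; apply: idealMl. Qed.

Inductive span (B : A -> Prop) : A -> Prop :=
| Span0 : span B 0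
| SpanS a b x : B b -> span B x -> span B (a *: b + x).

Lemma span_ideal (B I : A -> Prop) x : ideal I -> (forall b, B b -> I b) -> span B x -> I x.
Proof.
move=> iI BI; elim; first exact: ideal0.
by move=> a b y /BI Ib _ Iy; apply: idealD => //; apply: idealZ.
Qed.

Lemma span_mem (B : A -> Prop) b : B b -> span B b.
Proof. by move=> Bb; rewrite -[b]addr0 -[b]scale1r; apply: SpanS => //; apply: Span0. Qed.

Lemma spanD B x y : span B x -> span B y -> span B (x + y).
Proof.
by move=> Bx By; elim: Bx => [|a b z Bb _ IH]; rewrite ?add0r // -addrA; apply: SpanS.
Qed.

Lemma spanZ B a x : span B x -> span B (a *: x).
Proof.
elim=> [|c b z Bb _ IH]; first by rewrite scaler0; apply: Span0.
by rewrite scalerDr scalerA; apply: SpanS.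
Qed.

Lemma span_sum B (T : Type) (s : seq T) (P : pred T) (F : T -> A) :
  (forall i, P i -> span B (F i)) -> span B (\sum_(i <- s | P i) F i).
Proof. by move=> BF; apply: big_ind => //; [apply: Span0 | apply: spanD]. Qed.

Lemma span_trans (B B' : A -> Prop) x : (forall b, B b -> span B' b) -> span B x -> span B' x.
Proof.
move=> BB; elim=> [|c b z /BB Bb _ IH]; first exact: Span0.
by apply: spanD => //; apply: spanZ.
Qed.

Lemma spanM (B B' C : A -> Prop) x y :
  (forall b b', B b -> B' b' -> C (b * b')) -> span B x -> span B' y -> span C (x * y).
Proof.
move=> H Bx By; elim: Bx => [|a b z Bb _ IH]; first by rewrite mul0r; apply: Span0.
rewrite mulrDl; apply: spanD => //; rewrite -scalerAl; apply: spanZ.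
elim: By => [|a' b' z' Bb' _ IH']; first by rewrite mulr0; apply: Span0.
by rewrite mulrDr -scalerAr; apply: SpanS => //; apply: H.
Qed.

Definition mon (e : seq A) (w : seq nat) : A := \prod_(i <- w) e`_i.

Definition generates1 (e : seq A) :=
  (forall x, x \in e -> x \in G 1) /\
  (forall x, x \in G 1 -> span (fun b => b \in e) x).

Lemma generates1_exists : exists e, generates1 e.
Proof.
have [n [e [_ eE]]] := component1_fin G.
exists [seq e i | i : 'I_n]; split=> [_ /mapP[i _ ->]|x /eqP].
  apply/eE; exists (fun j => if j == i then 1 else 0).
  rewrite (bigD1 i) //= eqxx scale1r big1 ?addr0 // => j /negPf ->.
  by rewrite scale0r.
move/eqP/eE => [c ->]; apply: span_sum => i _; apply: spanZ; apply: span_mem.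
by apply: map_f; rewrite mem_enum.
Qed.

Lemma mon_cat e u v : mon e (u ++ v) = mon e u * mon e v.
Proof. exact: big_cat. Qed.

Lemma mon_in e w : (forall x, x \in e -> x \in G 1) -> mon e w \in G (size w).
Proof.
move=> eG; elim: w => [|i w IH]; first by rewrite /mon big_nil; apply: component_1.
rewrite /mon big_cons; apply: (@component_mul _ _ G 1) => //.
case: (ltnP i (size e)) => ie; first by apply: eG; apply: mem_nth.
by rewrite nth_default //; apply: component_0.
Qed.

Lemma hcomp_prod x y j : exists N, hcomp G (x * y) j =
  \sum_(k < N) (if (k <= j)%N then hcomp G x (j - k) * hcomp G y k else 0).
Proof.
have [N [_ _ yE]] := hcomp_decomposition G y; exists N.
rewrite [in LHS]yE mulr_sumr hcomp_sum; apply: eq_bigr => k _.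
by rewrite (hcompM _ _ (hcomp_in G y k)).
Qed.

(** The elements all of whose components are combinations of monomials of the right
    degree form a subalgebra that contains the generators. *)
Lemma span_monomials e x j : generates1 e -> x \in G j ->
  span (fun b => exists w, [/\ size w = j, all (fun i => i < size e)%N w & b = mon e w]) x.
Proof.
move=> [eG eE] Gx.
pose B j b := exists w, [/\ size w = j, all (fun i => i < size e)%N w & b = mon e w].
pose S : {pred A} := fun x => `[< forall j, span (B j) (hcomp G x j) >].
have SP y : (y \in S) = `[< forall j, span (B j) (hcomp G y j) >] by [].
suff : x \in S by rewrite SP => /asboolP/(_ j); rewrite (hcomp_hom _ Gx) eqxx.
apply: (@component1_generates _ _ G S).
  split.
  - rewrite SP; apply/asboolP => i; rewrite (hcomp_hom _ (component_1 G)).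
    case: eqP => [->|_]; last exact: Span0.
    by apply: span_mem; exists [::]; split=> //; rewrite /mon big_nil.
  - move=> a y z; rewrite !SP => /asboolP Sy /asboolP Sz; apply/asboolP => i.
    by rewrite hcomp_lin; apply: spanD => //; apply: spanZ.
  move=> y z; rewrite !SP => /asboolP Sy /asboolP Sz; apply/asboolP => i.
  have [N ->] := hcomp_prod y z i; apply: span_sum => k _.
  case: leqP => ki; last exact: Span0.
  apply: (spanM _ (Sy _) (Sz _)) => _ _ [u [su ue ->]] [v [sv ve ->]].
  by exists (u ++ v); rewrite size_cat su sv subnK // all_cat ue ve mon_cat.
move=> y Gy; rewrite SP; apply/asboolP => i; rewrite (hcomp_hom _ Gy).
case: eqP => [->|_]; last exact: Span0.
apply: span_trans (eE y Gy) => b be; apply: span_mem; exists [:: index b e].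
by split=> //=; rewrite ?index_mem ?be // /mon big_seq1 nth_index.
Qed.

(** Pigeonhole: a long monomial contains a high power of one of the finitely many
    generators. *)
Lemma nilpotent_generators e I : ideal I -> generates1 e ->
  (forall x, x \in e -> exists n, I (x ^+ n)) ->
  exists N, forall j x, (N <= j)%N -> x \in G j -> I x.
Proof.
move=> iI ge nil.
suff [N H] : exists N, forall w : seq A, (N <= size w)%N -> {subset w <= e} ->
    I (\prod_(x <- w) x).
  exists N => j x Nj Gx; apply: (span_ideal iI _ (span_monomials ge Gx)).
  move=> _ [w [sw we ->]]; rewrite /mon -(big_map (nth 0 e) predT id).
  apply: H; first by rewrite size_map sw.
  by move=> _ /mapP[i iw ->]; apply/mem_nth/(allP we).
elim: (e) nil => [|x l IH] nil.
  by exists 1%N => -[//|y w] _ /(_ y (mem_head _ _)).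
have [|N H] := IH; first by move=> y yl; apply: nil; rewrite inE yl orbT.
have [n In] := nil x (mem_head _ _).
exists (N + n)%N => w Nw wl.
rewrite -(perm_big _ (permEl (perm_filterC (pred1 x) w))) big_cat /=.
have sz : (size (filter (pred1 x) w) + size (filter (predC (pred1 x)) w) = size w)%N.
  by rewrite -size_cat (perm_size (permEl (perm_filterC _ _))).
case: (leqP n (size (filter (pred1 x) w))) => nw.
  rewrite mulrC; apply: (idealMl iI).
  have /all_pred1P -> := filter_all (pred1 x) w.
  by rewrite big_nseq iter_mulr_1 -(subnK nw) exprD; apply: (idealMl iI).
apply: (idealMl iI); apply: H.
  rewrite -(leq_add2l n) addnC (leq_trans Nw) // -sz leq_add2r.
  exact: ltnW.
move=> y; rewrite mem_filter => /andP[/= yx /wl]; rewrite inE (negbTE yx) //.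
Qed.

End Monomials.

(** * Linear regular sequences *)

Lemma nonroot_exists (K : fieldType) (p : {poly K}) :
  [pchar K] =i pred0 -> p != 0 -> exists t, p.[t] != 0.
Proof.
move=> char0 p0; apply: contrapT => H.
have rootp t : root p t by apply: contrapT => nt; apply: H; exists t; apply/negP.
pose s := [seq (k%:R : K) | k <- iota 0 (size p)].
have : (size s < size p)%N.
  apply: max_poly_roots => //; first by apply/allP.
  rewrite map_inj_uniq ?iota_uniq // => i j /eqP.
  wlog ij : i j / (i <= j)%N.
    by move=> W; case: (leqP i j) => [|/ltnW] ij e; [apply: W | apply/esym/W; rewrite // eq_sym].
  rewrite eq_sym -subr_eq0 -natrB // => /eqP/eqP.
  have := (pcharf0P K).1 char0 (j - i)%N => ->.
  by rewrite subn_eq0 => ji; apply/eqP; rewrite eqn_leq ij.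
by rewrite size_map size_iota ltnn.
Qed.

Section GradedRegular.
Variables (K : fieldType) (A : comAlgType K) (G : standard_grading A).
Implicit Types (x y f l : A) (s : seq A) (I : A -> Prop).

Lemma homogeneous_adjoins I s : ideal I -> homogeneous G I ->
  (forall x, x \in s -> exists j, x \in G j) -> homogeneous G (adjoins I s).
Proof.
elim: s I => //= x s IH I iI hI sG; apply: IH; first exact: ideal_adjoin.
  by have [j Gx] := sG x (mem_head _ _); apply: homogeneous_adjoin Gx.
by move=> y ys; apply: sG; rewrite inE ys orbT.
Qed.

Definition irrelevant : {pred A} := fun x => hcomp G x 0 == 0.

Lemma hcompM0 x y : hcomp G (x * y) 0 = hcomp G x 0 * hcomp G y 0.
Proof.
have [N [Gy y0 yE]] := hcomp_decomposition G y.
rewrite [in LHS]yE mulr_sumr hcomp_sum.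
under eq_bigr do rewrite (hcompM _ _ (hcomp_in G y _)) leqn0.
case: N Gy y0 yE => [|N] Gy y0 yE; first by rewrite big_ord0 y0 // mulr0.
by rewrite big_ord_recl /= big1 ?addr0.
Qed.

Lemma degree0_unit x : x \in G 0 -> x != 0 -> exists y, y * x = 1.
Proof.
move/component0=> [c ->] c0; exists (c^-1)%:A.
rewrite -scalerAl mul1r scalerA mulVf ?scale1r //.
by apply: contraNneq c0 => ->; rewrite scale0r.
Qed.

Lemma irrelevant_prime : prime_ideal irrelevant.
Proof.
have memE x : (x \in irrelevant) = (hcomp G x 0 == 0) by [].
split.
  split; first by rewrite memE hcomp0.
    by rewrite memE (hcomp_hom _ (component_1 G)) eqxx oner_eq0.
  move=> a x y; rewrite !memE hcompD hcompM0 => /eqP-> /eqP->.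
  by rewrite mulr0 addr0.
move=> x y; rewrite !memE hcompM0; case: (hcomp G x 0 =P 0) => //= /eqP x0.
have [z zx] := degree0_unit (hcomp_in G x 0) x0.
by move=> /eqP xy; rewrite -[hcomp G y 0]mul1r -zx -mulrA xy mulr0.
Qed.

(** If some element [x] of degree 1 were not nilpotent modulo [(s)], then a prime
    strictly below the irrelevant ideal would contain [s], and [length s] descents
    would extend this to a chain longer than the dimension. *)
Lemma quotient_finite (d : nat) s : (forall n P, @prime_chain A n P -> (n <= d)%N) ->
  size s = d -> (forall x, x \in s -> exists j, x \in G j) ->
  regular_from (@zero_ideal A) s ->
  exists N, forall j x, (N <= j)%N -> x \in G j -> adjoins (@zero_ideal A) s x.
Proof.
move=> dimA sd sG rs; have iZ := ideal_zero A.
set I := adjoins _ s; have iI : ideal I by apply: ideal_adjoins.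
have hI : homogeneous G I by apply: homogeneous_adjoins => //; apply: homogeneous_zero.
have [e ge] := generates1_exists G.
apply: (nilpotent_generators iI ge) => x xe; apply: contrapT => nil.
have Gx : x \in G 1 := ge.1 x xe.
pose S y := exists t k, t \notin irrelevant /\ y = t * x ^+ k.
have [m0 mM] := irrelevant_prime.
have m1 : 1 \notin irrelevant by case: m0.
have [||y Iy [t [k [t0 yE]]]|P [pP IP SP _]] := @exists_prime_avoiding _ I S iI.
- by exists 1, 0%N; rewrite mulr1.
- move=> _ _ [t [k [t0 ->]]] [u [l [u0 ->]]]; exists (t * u), (k + l)%N.
  split; last by rewrite exprD mulrACA.
  by apply/negP => /mM; rewrite (negbTE t0) (negbTE u0).
- apply: nil; exists k; have := hI _ k Iy.
  have Gxk : x ^+ k \in G k by have := componentX k Gx; rewrite muln1.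
  rewrite yE (hcompM _ _ Gxk) leqnn subnn => It.
  have [z zt] := degree0_unit (hcomp_in G t 0) t0.
  by rewrite -[x ^+ k]mul1r -zt -mulrA; apply: idealMl.
have [c [[pc lc] _ cs]] := prime_chain_below iZ rs pP IP.
pose c' i := if (i <= size s)%N then c i else irrelevant.
have /dimA : prime_chain (size s).+1 c'.
  split=> i.
    by move=> _; rewrite /c'; case: ifP => [/pc|_] //; apply: irrelevant_prime.
  rewrite ltnS /c' => is'; rewrite is'.
  case: ltnP => [/lc//|si].
  have -> : i = size s by apply/eqP; rewrite eqn_leq is'.
  rewrite cs; split.
    move=> y; apply: contraLR => my; apply: SP; exists y, 0%N.
    by rewrite mulr1.
  exists x; first by rewrite -topredE /= /irrelevant (hcomp_hom _ Gx).
  by apply: SP; exists 1, 1%N; rewrite mul1r.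
by rewrite sd ltnn.
Qed.

Lemma span_list (B : seq A) x : span (fun b => b \in B) x ->
  exists c : nat -> K, x = \sum_(i < size B) c i *: B`_i.
Proof.
elim=> [|a b y Bb _ [c ->]].
  by exists (fun=> 0); rewrite big1 // => i _; rewrite scale0r.
exists (fun i => (if i == index b B then a else 0) + c i).
under [RHS]eq_bigr do rewrite scalerDl.
rewrite big_split /=; congr (_ + _).
have ib : (index b B < size B)%N by rewrite index_mem.
rewrite (bigD1 (Ordinal ib)) //= eqxx nth_index // big1 ?addr0 // => i.
by rewrite -val_eqE /= => /negPf ->; rewrite scale0r.
Qed.

Fixpoint words_list (n m : nat) : seq (seq nat) :=
  if m is m'.+1 then [seq i :: w | i <- iota 0 n, w <- words_list n m'] else [:: [::]].

Lemma mem_words_list n m w :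
  (w \in words_list n m) = (size w == m) && all (fun i => i < n)%N w.
Proof.
elim: m w => [|m IH] [|i w] //=.
  by apply/negbTE/negP => /allpairsP[[j v] [_ _]].
rewrite eqSS; apply/allpairsP/idP => [[[j v] /= [+ + [-> ->]]]|].
  by rewrite mem_iota IH /= add0n => -> /andP[-> ->].
case/and3P=> sw lin aw; exists (i, w); split=> //=; first by rewrite mem_iota.
by rewrite IH sw.
Qed.

Lemma component_list j : exists B : seq A, forall x, x \in G j -> span (fun b => b \in B) x.
Proof.
have [e ge] := generates1_exists G.
exists [seq mon e w | w <- words_list (size e) j] => x /(span_monomials ge).
apply: span_trans => _ [w [sw aw ->]]; apply: span_mem; apply: map_f.
by rewrite mem_words_list sw eqxx.
Qed.

Lemma span_modM I (B : seq A) f x (c : nat -> K) : ideal I ->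
  I (x - \sum_(i < size B) c i *: B`_i) ->
  I (x * f - \sum_(i < size (map (fun b => b * f) B)) c i *: (map (fun b => b * f) B)`_i).
Proof.
move=> iI Ix; rewrite size_map.
rewrite (eq_bigr (fun i : 'I_(size B) => c i *: B`_i * f)); last first.
  by move=> i _; rewrite (nth_map 0) // scalerAl.
by rewrite -mulr_suml -mulrBl mulrC; apply: idealMl.
Qed.

(** Modulo [I] the components of large degree are obtained from those of small degree
    by multiplication with powers of [f], so their dimensions stay bounded. *)
Lemma bounded_components I f a N : ideal I -> homogeneous G I -> f \in G a -> (0 < a)%N ->
  (forall j x, (N <= j)%N -> x \in G j -> adjoin I f x) ->
  exists m, forall j, exists2 B : seq A, (size B <= m)%N &
    forall x, x \in G j -> exists c : nat -> K, I (x - \sum_(i < size B) c i *: B`_i).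
Proof.
move=> iI hI Gf a0 HN.
pose L j := projT1 (cid (component_list j)).
have LP j x : x \in G j -> span (fun b => b \in L j) x.
  exact: (projT2 (cid (component_list j))).
exists (\max_(j < N) size (L j))%N => j.
elim/ltn_ind: j => j IH; case: (ltnP j N) => jN.
  exists (L j); first exact: (leq_bigmax (Ordinal jN)).
  move=> x /LP/span_list[c ->]; exists c; rewrite subrr; exact: ideal0.
have Hx x (Gx : x \in G j) := adjoin_hom iI hI Gf Gx (HN _ _ jN Gx).
case: (leqP a j) Hx => aj Hx; last first.
  by exists [::] => // x /Hx; exists (fun=> 0); rewrite big_ord0 subr0.
have [|B szB BP] := IH (j - a)%N; first by lia.
exists (map (fun b => b * f) B); first by rewrite size_map.
move=> x /Hx[y Gy Ixy]; have [c Ic] := BP y Gy; exists c.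
by apply: (ideal_trans iI (span_modM f iI Ic)); rewrite opprB addrA subrK.
Qed.

Lemma dependent_mod I (B : seq A) m (w : nat -> A) : ideal I -> (size B <= m)%N ->
  (forall i, (i <= m)%N -> exists c : nat -> K, I (w i - \sum_(k < size B) c k *: B`_k)) ->
  exists p : {poly K},
    [/\ p != 0, (size p <= m.+1)%N & I (\sum_(i < m.+1) p`_i *: w i)].
Proof.
move=> iI szB HB.
have /choice[c cP] : forall i : 'I_m.+1, exists c : nat -> K,
    I (w i - \sum_(k < size B) c k *: B`_k).
  by move=> i; apply: HB; rewrite -ltnS.
pose M := \matrix_(i < m.+1, k < size B) c i k.
have : kermx M != 0.
  rewrite kermx_eq0 /row_free neq_ltn; apply/orP; left.
  by rewrite ltnS (leq_trans (rank_leq_col M)).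
case/rowV0Pn => v /sub_kermxP vM v0.
exists (\poly_(i < m.+1) v 0 (inord i)); split.
- apply: contraNneq v0 => p0; apply/eqP/rowP => i; rewrite mxE.
  by have := congr1 (fun p : {poly K} => p`_i) p0; rewrite coef_poly ltn_ord inord_val coef0.
- exact: size_poly.
have E : \sum_(i < m.+1) v 0 i *: (\sum_(k < size B) c i k *: B`_k) = 0.
  under eq_bigr do rewrite scaler_sumr.
  rewrite exchange_big /= big1 // => k _.
  under eq_bigr do rewrite scalerA.
  rewrite -scaler_suml; have := congr1 (fun M : 'rV_(size B) => M 0 k) vM.
  rewrite !mxE; under eq_bigr do rewrite mxE.
  by move=> ->; rewrite scale0r.
rewrite -[X in I X]subr0 -[in X in _ - X]E -sumrB; apply: ideal_sum => // i _.
by rewrite coef_poly ltn_ord inord_val -scalerBr; apply: idealZ.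
Qed.

(** With bounded components two linear forms [u], [v] satisfy a homogeneous equation
    [F(u, v) = 0]; if [F(t, 1) <> 0] then [v] is nilpotent modulo [u - t v]. *)
Lemma eliminate I m u v : [pchar K] =i pred0 -> ideal I ->
  (exists2 B : seq A, (size B <= m)%N &
    forall x, x \in G m -> exists c : nat -> K, I (x - \sum_(i < size B) c i *: B`_i)) ->
  u \in G 1 -> v \in G 1 -> exists t : K, adjoin I (u - t *: v) (v ^+ m).
Proof.
move=> char0 iI [B szB BP] Gu Gv.
have [|p [p0 szp Ip]] := @dependent_mod I B m (fun i => u ^+ i * v ^+ (m - i)) iI szB.
  move=> i im; apply: BP; rewrite -[m in G m](subnKC im).
  by have := component_mul (componentX i Gu) (componentX (m - i) Gv); rewrite !muln1.
have [t pt] := nonroot_exists char0 p0.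
exists t; set l := u - t *: v; have iJ : ideal (adjoin I l) by apply: ideal_adjoin.
suff Jp : adjoin I l (p.[t] *: v ^+ m).
  by rewrite -[v ^+ m]scale1r -(mulVf pt) -scalerA; apply: idealZ.
apply: (ideal_trans iJ (sub_adjoin l Ip)).
rewrite (horner_coef_wide t szp) scaler_suml -sumrB.
apply: ideal_sum => // i _; rewrite -scalerA -scalerBr; apply: idealZ => //.
have im : (i <= m)%N by rewrite -ltnS.
have -> : t ^+ i *: v ^+ m = (t *: v) ^+ i * v ^+ (m - i).
  by rewrite exprZn -scalerAl -exprD subnKC.
rewrite -mulrBl mulrC.
apply: idealMl => //; rewrite -opprB; apply: idealN => //; apply: ideal_expB => //.
exact: mem_adjoin.
Qed.

(** Elimination replaces the pair of a linear form [u] and a generator [v] by a single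
    linear form modulo which both are nilpotent. After all generators have been treated,
    every homogeneous element of positive degree is nilpotent, in particular [f]. *)
Lemma linear_parameter I f a N : [pchar K] =i pred0 -> ideal I -> homogeneous G I ->
  f \in G a -> (0 < a)%N -> (forall j x, (N <= j)%N -> x \in G j -> adjoin I f x) ->
  exists2 l, l \in G 1 & exists n, adjoin I l (f ^+ n).
Proof.
move=> char0 iI hI Gf a0 HN; have [m Hm] := bounded_components iI hI Gf a0 HN.
have [e ge] := generates1_exists G.
have [l Gl nil] : exists2 l, l \in G 1 & forall x, x \in e -> exists n, adjoin I l (x ^+ n).
  elim: (e) ge.1 => [|v e' IH] eG; first by exists 0 => //; apply: component_0.
  have [|u Gu nil] := IH; first by move=> x xe; apply: eG; rewrite inE xe orbT.
  have Gv : v \in G 1 by apply: eG; rewrite mem_head.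
  have [t Jv] := eliminate char0 iI (Hm m) Gu Gv; set l := u - t *: v in Jv.
  exists l; first by apply: componentB => //; apply: componentZ.
  have iJ : ideal (adjoin I l) by apply: ideal_adjoin.
  have Ju : adjoin I l (u ^+ m).
    apply: (ideal_trans iJ (idealZ (t ^+ m) iJ Jv)); rewrite -exprZn.
    by apply: ideal_expB => //; apply: mem_adjoin.
  move=> x; rewrite inE => /orP[/eqP->|/nil[n [b Ib]]]; first by exists m.
  exists (n * m)%N; rewrite exprM.
  apply: (ideal_trans iJ (y := (b * u) ^+ m)); first by rewrite exprMn; apply: idealMl.
  by apply: ideal_expB => //; apply: sub_adjoin.
exists l => //; have iJ : ideal (adjoin I l) by apply: ideal_adjoin.
have [N' HN'] := nilpotent_generators iJ ge nil; exists N'.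
by apply: HN' (componentX N' Gf); rewrite leq_pmulr.
Qed.

(** A divisor of a non-zero-divisor is a non-zero-divisor. *)
Lemma regular_of_power I f l n : ideal I -> regular_mod I f ->
  adjoin I l (f ^+ n) -> regular_mod I l.
Proof.
move=> iI rf [b Ib] y Ily; have : I (f ^+ n * y).
  rewrite -(subrK (b * l) (f ^+ n)) mulrDl -mulrA; apply: idealD => //.
    by rewrite mulrC; apply: idealMl.
  exact: idealMl.
by elim: n {Ib} => [|n IH]; rewrite ?mul1r // exprS -mulrA => /rf.
Qed.

(** The point is that [y] is regular modulo [I]. If [y z] is in [I], then [z] is a
    multiple of every power of [x] modulo [I], and since [x] has positive degree the
    components of [z] are in [I]. *)
Lemma regular_swap I x y s a : ideal I -> homogeneous G I -> x \in G a -> (0 < a)%N ->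
  regular_from I [:: x, y & s] -> regular_from I [:: y, x & s].
Proof.
move=> iI hI Gx a0 /= [rx [ry rs]].
have ryI : regular_mod I y.
  have pow n z : I (y * z) -> adjoin I (x ^+ n) z.
    elim: n z => [|n IH] z Iyz.
      by exists z; rewrite expr0 mulr1 subrr; apply: ideal0.
    have [b Ib] := ry z (sub_adjoin x Iyz).
    have Iyb : I (y * b).
      apply: rx; apply: (ideal_trans iI Iyz).
      by rewrite -opprB; apply: idealN; rewrite // (_ : _ - _ = y * (z - b * x));
        [apply: idealMl | ring].
    have [c Ic] := IH b Iyb; exists c.
    rewrite (_ : z - _ = (z - b * x) + x * (b - c * x ^+ n)).
      by apply: idealD => //; apply: idealMl.
    by rewrite exprS; ring.
  move=> z Iyz; have [N [_ _ ->]] := hcomp_decomposition G z.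
  apply: ideal_sum => // i _; have [b Ib] := pow i.+1 z Iyz.
  have := hI _ i Ib; rewrite hcompB (hcompM _ _ (componentX i.+1 Gx)).
  by rewrite leqNgt (leq_trans (ltnSn i)) ?leq_pmulr // subr0.
split=> //; split; last by rewrite adjoin_comm.
move=> z [b Ib]; have [|c Ic] := ry b.
  exists z; rewrite -opprB (_ : z * x - y * b = x * z - b * y); last by ring.
  exact: idealN.
exists c; apply: rx; rewrite (_ : x * _ = (x * z - b * y) + y * (b - c * x)); last by ring.
by apply: idealD => //; apply: idealMl.
Qed.

Lemma regular_rcons_cons I s x : ideal I -> homogeneous G I ->
  (forall y, y \in s -> exists2 j, (0 < j)%N & y \in G j) ->
  regular_from I (rcons s x) -> regular_from I (x :: s).
Proof.
elim: s I => // y s IH I iI hI sG /= [ry rs].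
have [j j0 Gy] := sG y (mem_head _ _).
apply: (regular_swap iI hI Gy j0); split=> //; apply: IH rs.
- exact: ideal_adjoin.
- exact: homogeneous_adjoin Gy.
by move=> z zs; apply: sG; rewrite inE zs orbT.
Qed.

(** The elements of a homogeneous regular sequence of length [dim A] are replaced by
    linear forms, one after the other: the last one gives way to a linear form that is
    regular modulo the others, which then moves to the front. *)
Lemma linear_regular_sequence (d : nat) s : [pchar K] =i pred0 ->
  (forall n P, @prime_chain A n P -> (n <= d)%N) ->
  size s = d -> (forall x, x \in s -> exists2 j, (0 < j)%N & x \in G j) ->
  regular_from (@zero_ideal A) s ->
  exists ls, [/\ size ls = d, forall x, x \in ls -> x \in G 1
    & regular_from (@zero_ideal A) ls].
Proof.
move=> char0 dimA sd sG rs; have iZ := ideal_zero A; have hZ := homogeneous_zero G.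
suff H k : (k <= d)%N -> exists ls s', [/\ size ls = k, size (ls ++ s') = d,
    forall x, x \in ls -> x \in G 1,
    forall x, x \in s' -> exists2 j, (0 < j)%N & x \in G j
    & regular_from (@zero_ideal A) (ls ++ s')].
  have [ls [s' [lsd ssd lG _ rls]]] := H d (leqnn d).
  exists ls; split=> //; move: rls; rewrite (_ : s' = [::]) ?cats0 //.
  by apply: size0nil; move: ssd; rewrite size_cat lsd; lia.
elim: k => [|k IH] kd; first by exists [::], s.
have [ls [s' [lsk ssd lG s'G rls]]] := IH (ltnW kd).
case/lastP: s' => [|s' f] in ssd s'G rls *.
  by move: ssd kd; rewrite cats0 lsk => ->; rewrite ltnn.
rewrite -rcons_cat in ssd rls; set u := ls ++ s' in ssd rls.
have uG x : x \in u -> exists2 j, (0 < j)%N & x \in G j.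
  rewrite mem_cat => /orP[/lG Gx|xs]; first by exists 1%N.
  by apply: s'G; rewrite mem_rcons inE xs orbT.
have [a a0 Gf] : exists2 j, (0 < j)%N & f \in G j.
  by apply: s'G; rewrite mem_rcons mem_head.
have [|N HN] := quotient_finite dimA ssd _ rls.
  by move=> x; rewrite mem_rcons inE => /orP[/eqP->|/uG[j _ Gx]]; [exists a | exists j].
rewrite adjoins_rcons in HN; case/regular_from_rcons: rls => ru rf.
have iI : ideal (adjoins (@zero_ideal A) u) by apply: ideal_adjoins.
have hI : homogeneous G (adjoins (@zero_ideal A) u).
  by apply: homogeneous_adjoins => // x /uG[j _ Gx]; exists j.
have [l Gl [n Hn]] := linear_parameter char0 iI hI Gf a0 HN.
have rl := regular_of_power iI rf Hn.
exists (l :: ls), s'; split=> //=.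
- by rewrite lsk.
- by move: ssd; rewrite size_rcons.
- by move=> x; rewrite inE => /orP[/eqP->|/lG].
- by move=> x xs; apply: s'G; rewrite mem_rcons inE xs orbT.
by apply: regular_rcons_cons => //; apply/regular_from_rcons.
Qed.

End GradedRegular.

(** * Weights of words *)

Section Weight.
Variable B : nat.
Local Open Scope nat_scope.

(** The weight is additive under concatenation, so comparing weights is compatible with
    the multiplication of monomials. *)
Definition weight (w : seq nat) : nat := \sum_(i <- w) B ^ i.

Lemma weight_cat u v : weight (u ++ v) = weight u + weight v.
Proof. exact: big_cat. Qed.

Lemma perm_weight u v : perm_eq u v -> weight u = weight v.
Proof. by move=> uv; apply: perm_big. Qed.

(** Words of length below [B] are determined by their weights, which count the
    occurrences of each letter in base [B]. *)
Lemma weight_inj w w' : sorted leq w -> sorted leq w' -> size w = size w' ->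
  size w < B -> weight w = weight w' -> w = w'.
Proof.
have lt u p u' p' : sorted leq (rcons u p) -> (size u).+1 < B -> p < p' ->
    weight (rcons u p) < weight (rcons u' p').
  rewrite -!cats1 sorted_leq_cat => /and3P[/allrelP up _ _] sB pp'.
  apply: (@leq_trans (B ^ p')); last first.
    by rewrite weight_cat /weight big_seq1 leq_addl.
  apply: (@leq_trans (B ^ p.+1)); last by rewrite leq_pexp2l //; lia.
  apply: (@leq_ltn_trans ((size u).+1 * B ^ p)); last first.
    by rewrite expnS ltn_pmul2r // expn_gt0; lia.
  rewrite weight_cat {2}/weight big_seq1 mulSn addnC leq_add2l.
  rewrite /weight -sum1_size big_distrl /= big_seq [leqRHS]big_seq.
  apply: leq_sum => i iu; rewrite mul1n leq_pexp2l //; first by lia.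
  by apply: up; rewrite ?mem_head.
elim/last_ind: w w' => [|u p IH] w'; first by case: w'.
case/lastP: w' => [|u' p']; first by rewrite size_rcons.
rewrite !size_rcons => su su' [szu] sB wE.
have pp : p = p'.
  case: (ltngtP p p') => // pp.
    by have := lt u p u' p' su sB pp; rewrite wE ltnn.
  by have := lt u' p' u p su'; rewrite -szu wE ltnn => /(_ sB pp).
rewrite pp in wE su *; congr rcons; apply: IH => //; last 2 first.
- by apply: ltnW.
- by move: wE; rewrite -!cats1 !weight_cat => /addIn.
- by move: su; rewrite -cats1 sorted_leq_cat => /and3P[].
by move: su'; rewrite -cats1 sorted_leq_cat => /and3P[].
Qed.

End Weight.

(** * Dimensions modulo an ideal *)

Section Dimensions.
Variables (K : fieldType) (A : comAlgType K) (G : standard_grading A).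
Implicit Types (x y l : A) (I : A -> Prop).

Definition basis_mod I j (B : seq A) :=
  [/\ forall b, b \in B -> b \in G j,
      forall x, x \in G j -> exists c : nat -> K, I (x - \sum_(i < size B) c i *: B`_i)
    & forall c : nat -> K, I (\sum_(i < size B) c i *: B`_i) ->
        forall i, (i < size B)%N -> c i = 0].

Lemma sum_cat_map (c : nat -> K) (B1 B2 : seq A) l :
  \sum_(i < size (B1 ++ [seq l * b | b <- B2])) c i *: (B1 ++ [seq l * b | b <- B2])`_i
  = \sum_(i < size B1) c i *: B1`_i
    + l * \sum_(i < size B2) c (size B1 + i)%N *: B2`_i.
Proof.
rewrite size_cat size_map big_split_ord /=; congr (_ + _).
  by apply: eq_bigr => i _; rewrite nth_cat ltn_ord.
rewrite mulr_sumr; apply: eq_bigr => i _.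
by rewrite nth_cat ltnNge leq_addr /= addKn (nth_map 0) // scalerAr.
Qed.

(** The exact sequence [0 -> (A/I)_j -> (A/I)_(j+1) -> (A/(I + l))_(j+1) -> 0] given by
    multiplication with a linear form [l] that is regular modulo [I]. *)
Lemma basis_modS I l j B1 B2 : ideal I -> homogeneous G I -> l \in G 1 ->
  regular_mod I l -> basis_mod (adjoin I l) j.+1 B1 -> basis_mod I j B2 ->
  basis_mod I j.+1 (B1 ++ [seq l * b | b <- B2]).
Proof.
move=> iI hI Gl rl [B1G B1s B1f] [B2G B2s B2f]; split.
- move=> b; rewrite mem_cat => /orP[/B1G//|/mapP[a /B2G Ga ->]].
  exact: (@component_mul _ _ G 1).
- move=> x Gx; have [c Jc] := B1s x Gx.
  have Gz : x - \sum_(i < size B1) c i *: B1`_i \in G j.+1.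
    apply: componentB => //; apply: component_sum => i _; apply: componentZ.
    by apply: B1G; apply: mem_nth.
  have := adjoin_hom iI hI Gl Gz Jc; rewrite subn1 /= => -[a Ga Ia].
  have [c' Ic'] := B2s a Ga.
  pose c2 i := if (i < size B1)%N then c i else c' (i - size B1)%N.
  exists c2; rewrite sum_cat_map /c2.
  under eq_bigr do rewrite ltn_ord.
  under [X in l * X]eq_bigr do rewrite ltnNge leq_addr /= addKn.
  rewrite opprD addrA; apply: (ideal_trans iI Ia).
  rewrite (_ : _ - _ = l * (a - \sum_(i < size B2) c' i *: B2`_i)); last by ring.
  exact: idealMl.
move=> c; rewrite sum_cat_map => Ic.
have c1 : forall i, (i < size B1)%N -> c i = 0.
  apply: B1f; set s2 := (X in _ + l * X) in Ic; exists (- s2).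
  by rewrite mulNr opprK mulrC.
have c2 : forall i, (i < size B2)%N -> c (size B1 + i)%N = 0.
  apply: (B2f (fun i => c (size B1 + i)%N)); apply: rl; move: Ic.
  by rewrite big1 ?add0r // => i _; rewrite c1 ?scale0r.
move=> i; rewrite size_cat size_map => lti.
case: (ltnP i (size B1)) => [/c1//|le].
by rewrite -(subnKC le) c2 // ltn_subLR.
Qed.

Lemma basis_mod0 I l B : ideal I -> homogeneous G I -> l \in G 1 ->
  basis_mod (adjoin I l) 0 B -> basis_mod I 0 B.
Proof.
move=> iI hI Gl [BG Bs Bf]; split=> // [x Gx|c Ic]; last first.
  by apply: Bf; apply: sub_adjoin.
have [c Jc] := Bs x Gx; exists c.
have Gz : x - \sum_(i < size B) c i *: B`_i \in G 0.
  apply: componentB => //; apply: component_sum => i _; apply: componentZ.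
  by apply: BG; apply: mem_nth.
exact: (adjoin_hom iI hI Gl Gz Jc).
Qed.

Definition psum (f : nat -> nat) (j : nat) : nat := (\sum_(i < j.+1) f i)%N.

Lemma dims_adjoin I l f : ideal I -> homogeneous G I -> l \in G 1 -> regular_mod I l ->
  (forall j, exists2 B, basis_mod (adjoin I l) j B & size B = f j) ->
  forall j, exists2 B, basis_mod I j B & size B = psum f j.
Proof.
move=> iI hI Gl rl Hf; elim=> [|j [B2 bB2 sB2]].
  have [B bB sB] := Hf 0%N; exists B; first exact: basis_mod0 bB.
  by rewrite /psum big_ord1.
have [B1 bB1 sB1] := Hf j.+1.
exists (B1 ++ [seq l * b | b <- B2]); first exact: basis_modS.
by rewrite size_cat size_map sB1 sB2 /psum [RHS]big_ord_recr /= addnC.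
Qed.

Lemma dims_adjoins I ls f : ideal I -> homogeneous G I ->
  (forall x, x \in ls -> x \in G 1) -> regular_from I ls ->
  (forall j, exists2 B, basis_mod (adjoins I ls) j B & size B = f j) ->
  forall j, exists2 B, basis_mod I j B & size B = iter (size ls) psum f j.
Proof.
elim: ls I => [|l ls IH] I iI hI lG /=; first by [].
move=> [rl rls] Hf; have Gl : l \in G 1 by apply: lG; rewrite mem_head.
apply: (dims_adjoin iI hI Gl rl); apply: IH => //.
- exact: ideal_adjoin.
- exact: homogeneous_adjoin Gl.
by move=> x xl; apply: lG; rewrite inE xl orbT.
Qed.

Lemma basis_mod_has_dim j B : basis_mod (@zero_ideal A) j B -> has_dim (G j) (size B).
Proof.
case=> BG Bs Bf; exists (fun i => B`_i); split.
  move=> c c0 i; have := Bf (fun k => if insub k is Some i then c i else 0).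
  have E : \sum_(i < size B) (if insub (i : nat) is Some i then c i else 0) *: B`_i
       = \sum_i c i *: B`_i by apply: eq_bigr => k _; rewrite valK.
  by rewrite E => /(_ c0 i (ltn_ord i)); rewrite valK.
move=> v; split=> [/Bs[c] /eqP|[c ->]].
  by rewrite subr_eq0 => /eqP ->; exists (fun i => c i).
by apply: component_sum => i _; apply: componentZ; apply: BG; apply: mem_nth.
Qed.

(** * Standard monomials *)

Section Standard.
Variables (I : A -> Prop) (e : seq A) (N : nat).
Hypotheses (iI : ideal I) (ge : generates1 G e).
Hypothesis proper : ~ I 1.
Hypothesis finI : forall j x, (N <= j)%N -> x \in G j -> I x.

(* The base exceeds the lengths of all standard words. *)
Let wt := weight N.+1.

Definition smaller_monomial (w : seq nat) (b : A) : Prop :=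
  exists v, [/\ size v = size w, (wt v < wt w)%N & b = mon e v].

Definition reducible (w : seq nat) : Prop :=
  exists2 y, span (smaller_monomial w) y & I (mon e w - y).

Definition standard (w : seq nat) : bool := sorted leq w && `[< ~ reducible w >].

Definition standard_words (m : nat) := filter standard (words_list (size e) m).

Lemma reducible_in w : I (mon e w) -> reducible w.
Proof. by move=> Iw; exists 0; [apply: Span0 | rewrite subr0]. Qed.

Lemma standard_sorted w : standard w -> sorted leq w.
Proof. by case/andP. Qed.

Lemma standard_lt w : standard w -> all (fun i => i < size e)%N w.
Proof.
case/andP=> _ /asboolP nr; apply/allP => i iw; rewrite ltnNge; apply/negP => ei.
apply/nr/reducible_in; rewrite /mon (big_rem i) //= nth_default // mul0r.
exact: ideal0.
Qed.

Lemma standard_size w : standard w -> (size w < N)%N.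
Proof.
case/andP=> _ /asboolP nr; rewrite ltnNge; apply/negP => Nw.
by apply/nr/reducible_in; apply: finI Nw _; apply: mon_in ge.1.
Qed.

Lemma standard_nil : standard [::].
Proof.
apply/andP; split=> //; apply/asboolP => -[y sy].
have -> : y = 0.
  case: sy => // a b z [v [/size0nil -> ]]; by rewrite ltnn.
by rewrite subr0 /mon big_nil.
Qed.

(** If [u] is a combination of smaller monomials modulo [I], then so is [w]: multiply by
    the complementary factor of [w]. *)
Lemma standard_subseq u w : subseq u w -> standard w -> standard u.
Proof.
move=> uw /andP[sw /asboolP nr]; apply/andP; split.
  exact: (subseq_sorted leq_trans uw).
apply/asboolP => -[y sy Iy]; apply: nr.
have [v pw] := perm_to_subseq uw.
have mE : mon e w = mon e u * mon e v by rewrite -mon_cat; apply: perm_big.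
exists (y * mon e v); last by rewrite mE -mulrBl mulrC; apply: idealMl.
apply: (spanM (B' := fun b => b = mon e v) _ sy); last exact: span_mem.
move=> _ _ [t [st wtt ->]] ->; exists (t ++ v); split; last by rewrite mon_cat.
  by rewrite size_cat st (perm_size pw) size_cat.
by rewrite /wt (perm_weight _ pw) !weight_cat ltn_add2r.
Qed.

Lemma words_list_uniq n m : uniq (words_list n m).
Proof.
elim: m => //= m IH; apply: allpairs_uniq; rewrite ?iota_uniq //.
by move=> [i u] [j v] _ _ /= [-> ->].
Qed.

Lemma standard_words_enum : enumerates standard_words standard.
Proof.
move=> m; split; first by rewrite filter_uniq // words_list_uniq.
move=> w; rewrite mem_filter mem_words_list.
by case: (boolP (standard w)) => //= /standard_lt ->; rewrite andbT.
Qed.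

Lemma span_mod_trans (B B' : A -> Prop) x :
  (forall b, B b -> exists2 y, span B' y & I (b - y)) -> span B x ->
  exists2 y, span B' y & I (x - y).
Proof.
move=> BB; elim=> [|a b z /BB[y sy Iy] _ [y' sy' Iy']].
  by exists 0; [apply: Span0 | rewrite subrr; apply: ideal0].
exists (a *: y + y'); first by apply: spanD => //; apply: spanZ.
rewrite (_ : _ - _ = a *: (b - y) + (z - y')).
  by apply: idealD => //; apply: idealZ.
by rewrite scalerBr opprD addrACA.
Qed.

(** Induction on the weight: a monomial that is not standard is a combination of smaller
    ones. *)
Lemma standard_span j x : x \in G j ->
  exists2 y, span (fun b => b \in [seq mon e w | w <- standard_words j]) y & I (x - y).
Proof.
move/(span_monomials ge); apply: span_mod_trans => _ [w [sw _ ->]].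
move: {2}(wt w) (erefl (wt w)) => k; elim/ltn_ind: k w sw => k IH w sw wk.
have pw : perm_eq (sort leq w) w by rewrite perm_sort.
case: (pselect (reducible w)) => [[y sy Iy]|nr].
  have [z sz Iz] : exists2 z,
      span (fun b => b \in [seq mon e w | w <- standard_words j]) z & I (y - z).
    apply: span_mod_trans sy => _ [v [sv wv ->]].
    by apply: (IH (wt v)); rewrite -?wk // sv.
  by exists z => //; apply: (ideal_trans iI Iz); rewrite opprB addrA subrK.
exists (mon e w); last by rewrite subrr; apply: ideal0.
apply: span_mem; rewrite (_ : mon e w = mon e (sort leq w)); last first.
  by apply: perm_big; rewrite perm_sym.
apply: map_f; rewrite (standard_words_enum j).2 size_sort sw eqxx andbT.
apply/andP; split; first exact: (sort_sorted leq_total).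
apply/asboolP => -[y sy Iy]; apply: nr; exists y.
  apply: span_trans sy => _ [v [sv wv ->]]; apply: span_mem; exists v; split=> //.
    by rewrite sv size_sort.
  by rewrite /wt -(perm_weight _ pw).
by rewrite (_ : mon e w = mon e (sort leq w)) //; apply: perm_big; rewrite perm_sym.
Qed.

(** In a linear relation between standard monomials, the one of largest weight would be
    a combination of smaller ones. *)
Lemma standard_basis j : basis_mod I j [seq mon e w | w <- standard_words j].
Proof.
set W := standard_words j.
have WP w : w \in W -> standard w /\ size w = j.
  by rewrite (standard_words_enum j).2 => /andP[? /eqP].
split.
- by move=> _ /mapP[w /WP[_ <-] ->]; apply: mon_in ge.1.
- by move=> x /standard_span[y /span_list[c ->] Iy]; exists c.
move=> c; rewrite size_map => Ic i0 lti0; apply/eqP; apply: contrapT => /negP ci0.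
pose w (i : 'I_(size W)) := nth [::] W i.
have wW i : w i \in W by apply: mem_nth.
case: (@arg_maxnP _ (Ordinal lti0) (fun i : 'I_(size W) => c i != 0) (fun i => wt (w i)) ci0).
move=> i ci imax; have [/andP[_ /asboolP nr] szi] := WP _ (wW i); apply: nr.
exists (\sum_(k < size W | k != i) (- (c k / c i)) *: mon e (w k)).
  apply: span_sum => k ki; case: (eqVneq (c k) 0) => [->|ck].
    by rewrite mul0r oppr0 scale0r; apply: Span0.
  apply: spanZ; apply: span_mem; exists (w k); have [stk szk] := WP _ (wW k).
  rewrite szk szi; split=> //; rewrite ltn_neqAle; apply/andP; split; last exact: imax.
  apply: contra ki => /eqP wki; apply/eqP/val_inj/eqP.
  rewrite -(nth_uniq [::] (ltn_ord k) (ltn_ord i) (standard_words_enum j).1).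
  have [sti _] := WP _ (wW i); apply/eqP; apply: (@weight_inj N.+1) => //.
  - exact: standard_sorted stk.
  - exact: standard_sorted sti.
  - by rewrite szk szi.
  - exact/ltnW/standard_size.
have := idealZ (c i)^-1 iI Ic; rewrite (bigD1 i) //= scalerDr scalerA mulVf // scale1r.
rewrite (nth_map [::]) // scaler_sumr; congr (I (_ + _)).
rewrite -sumrN; apply: eq_bigr => k _.
by rewrite (nth_map [::]) // scalerA scaleNr opprK [_^-1 * _]mulrC.
Qed.

End Standard.

End Dimensions.

(** * Hilbert series as convolutions *)

(** The product of [p] with the power series whose coefficients are the values of
    [f]. *)
Definition conv (p : {poly int}) (f : nat -> int) (n : nat) : int :=
  \sum_(j < n.+1) p`_j * f (n - j)%N.

Lemma conv_poly p f n m : (m <= n)%N -> conv p f m = (p * \poly_(i < n.+1) f i)`_m.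
Proof.
move=> mn; rewrite coefM; apply: eq_bigr => j _.
by rewrite coef_poly ltnS (leq_trans (leq_subr _ _)).
Qed.

Lemma convM p q f n : conv (p * q) f n = conv p (conv q f) n.
Proof.
rewrite (conv_poly _ _ (leqnn n)) -mulrA coefM; apply: eq_bigr => j _.
by rewrite (conv_poly _ _ (leq_subr j n)).
Qed.

Lemma eq_conv p f g : f =1 g -> conv p f =1 conv p g.
Proof. by move=> fg n; apply: eq_bigr => j _; rewrite fg. Qed.

(** Partial summation is division by [1 - t]. *)
Lemma conv_psum (f : nat -> nat) n :
  conv (1 - 'X) (fun i => (psum f i)%:Z) n = (f n)%:Z.
Proof.
rewrite (conv_poly _ _ (leqnn n)) mulrBl mul1r coefB mulrC coefMX !coef_poly ltnSn.
case: n => [|n] /=; first by rewrite /psum big_ord1 subr0.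
by rewrite ltnW // /psum big_ord_recr /= PoszD addrAC subrr add0r.
Qed.

Lemma conv_iter_psum d (f : nat -> nat) n :
  conv ((1 - 'X) ^+ d) (fun i => (iter d psum f i)%:Z) n = (f n)%:Z.
Proof.
elim: d n => [|d IH] n.
  rewrite /conv big_ord_recl subn0 expr0 coef1 mul1r big1 ?addr0 //= => i _.
  by rewrite coef1 mul0r.
rewrite exprSr convM -IH; apply: eq_conv => i.
by rewrite iterS conv_psum.
Qed.

(** [p \Po 'X^r] has only exponents divisible by [r], so at a multiple of [r] it meets
    the values of [f] at multiples of [r] alone. *)
Lemma conv_comp_Xn p f r n : (0 < r)%N ->
  conv (p \Po 'X^r) f (n * r) = conv p (fun i => f (i * r)%N) n.
Proof.
move=> r0; rewrite /conv.
rewrite (eq_bigr (fun j : 'I_(n * r).+1 =>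
  if (r %| j)%N then p`_(j %/ r) * f (n * r - j)%N else 0)); last first.
  by move=> j _; rewrite coef_comp_poly_Xn //; case: ifP; rewrite ?mul0r.
rewrite -big_mkcond /=.
rewrite (reindex_onto (fun k : 'I_n.+1 => inord (k * r)) (fun j => inord (j %/ r))) /=.
  apply: eq_big => k.
    have kr : (k * r < (n * r).+1)%N by rewrite ltnS leq_mul2r -ltnS ltn_ord orbT.
    by rewrite inordK // dvdn_mull // mulnK // inord_val eqxx.
  move=> _; have kr : (k * r < (n * r).+1)%N by rewrite ltnS leq_mul2r -ltnS ltn_ord orbT.
  by rewrite inordK // mulnK // mulnBl.
move=> j rj; have jn : (j %/ r < n.+1)%N by rewrite ltnS leq_divLR // -ltnS.
by rewrite (inordK jn) divnK // inord_val.
Qed.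

(** [(1 - t^r)^d = (1 + ... + t^(r-1))^d (1 - t)^d] applied to the Hilbert series, whose
    product with the last factor is [h]. *)
Lemma hilbert_veronese d r (f : nat -> nat) (h : {poly int}) n : (0 < r)%N ->
  (forall j, h`_j = (f j)%:Z) ->
  (h * geo r ^+ d)`_(n * r)
    = conv ((1 - 'X) ^+ d) (fun i => (iter d psum f (i * r)%N)%:Z) n.
Proof.
move=> r0 hE; rewrite -(conv_comp_Xn _ (fun i => (iter d psum f i)%:Z)) //.
have -> : (1 - 'X : {poly int}) ^+ d \Po 'X^r = geo r ^+ d * (1 - 'X) ^+ d.
  by rewrite -exprMn geo_mul1X rmorphXn /= rmorphB /= comp_polyC comp_polyX.
rewrite convM mulrC coefM; apply: eq_bigr => j _.
by rewrite conv_iter_psum hE.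
Qed.

(** * Uniqueness of dimensions *)

Lemma has_dim_leq (K : fieldType) (A : comAlgType K) (V : {pred A}) m n :
  has_dim V m -> has_dim V n -> (m <= n)%N.
Proof.
move=> [e [e_free eV]] [e' [_ e'V]]; rewrite leqNgt; apply/negP => nm.
pose B := [seq e' i | i : 'I_n].
have szB : size B = n by rewrite size_map size_enum_ord.
pose w i := if insub i is Some k then e k else 0.
have iZ := ideal_zero A.
case: m e e_free eV nm @w => // m e e_free eV nm w.
have [|i im|p [p0 szp pw]] := @dependent_mod K A (@zero_ideal A) B m w iZ.
- by rewrite szB.
- have ltim : (i < m.+1)%N by [].
  have /e'V[c wE] : w i \in V.
    rewrite /w (insubT (fun k => k < m.+1)%N ltim); apply/eV.
    exists (fun k => if k == Ordinal ltim then 1 else 0).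
    rewrite (bigD1 (Ordinal ltim)) //= eqxx scale1r big1 ?addr0 // => k /negPf ->.
    by rewrite scale0r.
  exists (fun k => if insub k is Some k' then c k' else 0).
  rewrite /zero_ideal wE; apply/eqP; rewrite subr_eq0; apply/eqP.
  rewrite szB; apply: eq_bigr => k _; rewrite valK.
  by rewrite (nth_map k) ?size_enum_ord // nth_ord_enum.
case/eqP: p0; apply/polyP => i; rewrite coef0; case: (ltnP i m.+1) => im.
  apply: (e_free (fun k : 'I_m.+1 => p`_k) _ (Ordinal im)).
  by rewrite -[RHS]pw; apply: eq_bigr => k _; rewrite /w valK.
by apply: nth_default; apply: leq_trans im.
Qed.

Lemma has_dim_uniq (K : fieldType) (A : comAlgType K) (V : {pred A}) m n :
  has_dim V m -> has_dim V n -> m = n.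
Proof.
by move=> Vm Vn; apply/eqP; rewrite eqn_leq (has_dim_leq Vm Vn) (has_dim_leq Vn Vm).
Qed.

Lemma has_krull_dim_uniq (R : comNzRingType) m n :
  has_krull_dim R m -> has_krull_dim R n -> m = n.
Proof.
move=> [[P cP] Pm] [[Q cQ] Qn]; apply/eqP.
by rewrite eqn_leq (Qn _ _ cP) (Pm _ _ cQ).
Qed.

Lemma hpolyE (K : fieldType) (A : comAlgType K) (G : nat -> {pred A}) h :
  is_hpoly G h -> hpoly G = h.
Proof.
move=> hG; apply: classical_sets.xget_unique => // h' [d' [H' [dimA' GH' h'E]]].
case: hG => d [H [dimA GH hE]]; apply/polyP => n.
rewrite h'E hE (has_krull_dim_uniq dimA dimA'); apply: eq_bigr => j _.
by rewrite (has_dim_uniq (GH (n - j)%N) (GH' _)).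
Qed.

(** * Krull dimension along integral extensions *)

Section IntegralExtension.
Variables (R S : comNzRingType) (f : {rmorphism R -> S}).
Hypothesis f_inj : injective f.
Hypothesis f_int : integralRange f.

Definition contract (Q : {pred S}) : {pred R} := fun x => f x \in Q.

Let contractE Q x : (x \in contract Q) = (f x \in Q). Proof. by []. Qed.

Lemma contract_prime Q : prime_ideal Q -> prime_ideal (contract Q).
Proof.
move=> [[Q0 Q1 QL] QM]; split; last by move=> x y; rewrite !contractE rmorphM; apply: QM.
split; rewrite ?contractE ?rmorph0 ?rmorph1 // => a x y.
by rewrite !contractE rmorphD rmorphM; apply: QL.
Qed.

(** Lying over: an ideal [Q], maximal among those that contain [I] and miss the image of
    the complement of [p], contracts to [p]. If [x] were in [p] and [f x] not in [Q],
    then [Q] would contain some [f s - a * f x] with [s] outside [p], and multiplying a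
    monic equation of [a] by a power of [f x] would give a power of [s] in [p]. *)
Lemma lying_over (I : S -> Prop) (p : {pred R}) : ideal I -> prime_ideal p ->
  (forall x, I (f x) -> x \in p) ->
  exists Q : {pred S}, [/\ prime_ideal Q, forall y, I y -> y \in Q
    & forall x, (f x \in Q) = (x \in p)].
Proof.
move=> iI pp Ip; have [[p0 p1 pL] pM] := pp.
pose T y := exists2 x, x \notin p & y = f x.
have [||y Iy [x px yE]|Q [pQ IQ TQ Qmax]] := @exists_prime_avoiding _ I T iI.
- by exists 1; rewrite ?rmorph1.
- move=> _ _ [x px ->] [y py ->]; exists (x * y); rewrite ?rmorphM //.
  by apply/negP => /pM; rewrite (negbTE px) (negbTE py).
- by case/negP: px; apply: Ip; rewrite -yE.
have Qp x : f x \in Q -> x \in p.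
  by apply: contraLR => px; apply: TQ; exists x.
exists Q; split=> // x; apply/idP/idP; first exact: Qp.
move=> px; apply: contraT => /Qmax[_ [a [[s ps ->] Qs]]].
have [q q_monic /rootP qa] := f_int a.
have iQ := ideal_prime pQ.
have ip := ideal_prime pp.
pose n := (size q).-1.
have szq : size q = n.+1 by rewrite /n prednK // size_poly_gt0 monic_neq0.
(* The monic equation of [a], homogenised by [x], at [s]. *)
pose z := \sum_(i < n.+1) q`_i * x ^+ (n - i) * s ^+ i.
have Qz : f z \in Q.
  apply: (ideal_trans iQ (y := f x ^+ n * (map_poly f q).[a])).
    by rewrite qa mulr0; case: pQ => -[].
  rewrite horner_coef size_map_poly_id0; last first.
    by rewrite (eqP q_monic) rmorph1 oner_eq0.
  rewrite szq mulr_sumr rmorph_sum /= -sumrB; apply: (ideal_sum iQ) => i _.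
  rewrite coef_map !rmorphM !rmorphXn /=.
  have im : (i <= n)%N by rewrite -ltnS.
  have -> : f x ^+ n = f x ^+ (n - i) * f x ^+ i by rewrite -exprD subnK.
  rewrite (_ : _ - _ = f q`_i * f x ^+ (n - i) * (f s ^+ i - (a * f x) ^+ i)).
    by apply: (idealMl iQ); apply: (ideal_expB _ iQ).
  by rewrite exprMn; ring.
have ps_n : s ^+ n \in p.
  have -> : s ^+ n = z - \sum_(i < n) q`_i * x ^+ (n - i) * s ^+ i.
    rewrite /z big_ord_recr /= subnn expr0 mulr1 addrAC subrr add0r.
    by rewrite -[n]/((size q).-1) -lead_coefE (eqP q_monic) mul1r.
  apply: (idealB ip); first exact: Qp.
  apply: (ideal_sum ip) => i _; rewrite mulrAC.
  have -> : (n - i = (n - i).-1.+1)%N by rewrite prednK // subn_gt0.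
  rewrite exprSr mulrA; exact: (idealMl ip).
elim: n ps_n {szq z Qz} => [|k IH]; first by rewrite expr0 (negbTE p1).
by rewrite exprS => /pM; rewrite (negbTE ps) => /IH.
Qed.

(** Incomparability: if [x] is integral over [R] modulo [P] and lies in a larger prime
    with the same contraction, the constant coefficient of an equation of minimal degree
    is in the contraction, so [x] could be cancelled. *)
Lemma incomparable (P Q : {pred S}) x : prime_ideal P -> prime_ideal Q ->
  {subset P <= Q} -> (forall y, f y \in Q -> f y \in P) -> x \in Q -> x \in P.
Proof.
move=> pP pQ PQ QP Qx; have [[P0 P1 PL] PM] := pP.
have iP := ideal_prime pP; have iQ := ideal_prime pQ.
have [q q_monic /rootP qx] := f_int x.
suff H n (p : {poly R}) : size p = n.+1 -> p \is monic -> (map_poly f p).[x] \in P -> x \in P.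
  apply: (H (size q).-1 q) => //; last by rewrite qx.
  by rewrite prednK // size_poly_gt0 monic_neq0.
elim: n p => [|n IH] p szp p_monic.
  have /size_poly1P[c _ pc] : size p == 1%N by apply/eqP.
  move: p_monic; rewrite pc monicE lead_coefC => /eqP->.
  by rewrite polyC1 rmorph1 hornerE (negbTE P1).
set p' := drop_poly 1 p.
have szp' : size p' = n.+1 by rewrite size_drop_poly szp subn1.
have p'_monic : p' \is monic.
  by rewrite monicE lead_coefE szp' coef_drop_poly addn1 -[n.+1]/(n.+2.-1) -szp -lead_coefE.
have -> : map_poly f p = map_poly f p' * 'X + (f p`_0)%:P.
  rewrite -{1}(poly_take_drop 1 p) expr1 rmorphD rmorphM /= map_polyX addrC; congr (_ + _).
  have -> : take_poly 1 p = (p`_0)%:P.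
    by apply/polyP => -[|k]; rewrite coef_take_poly coefC.
  exact: map_polyC.
rewrite hornerD hornerM hornerX hornerC => Ppx.
have Pp0 : f p`_0 \in P.
  apply: QP; rewrite -(addKr ((map_poly f p').[x] * x) (f p`_0)) addrC.
  by apply: (idealB iQ); [apply: PQ | apply: (idealMl iQ)].
have : (map_poly f p').[x] * x \in P.
  by rewrite -[X in X \in P](addrK (f p`_0)); apply: (idealB iP).
by case/PM/orP => // /(IH p' szp' p'_monic).
Qed.

(** Chains in [S] contract to chains by incomparability; chains in [R] lift step by step
    by lying over. *)
Lemma integral_krull_dim d : has_krull_dim S d -> has_krull_dim R d.
Proof.
move=> [[c [pc lc]] dimS]; split.
  exists (fun i => contract (c i)); split=> i id.
    by apply: contract_prime; apply: pc.
  have [sub [y cy ncy]] := lc i id; split; first by move=> x; rewrite !contractE => /sub.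
  apply: contrapT => H; case/negP: ncy.
  apply: (incomparable (pc i (ltnW id)) (pc i.+1 id) sub _ cy) => z cz.
  by apply: contrapT => /negP ncz; apply: H; exists z.
move=> n p [pp lp]; suff [c' [chain' _]] : exists c' : nat -> {pred S},
    prime_chain n c' /\ forall i x, (i <= n)%N -> (f x \in c' i) = (x \in p i).
  exact: dimS chain'.
elim: n pp lp => [|n IH] pp lp.
  have [|Q [pQ _ Qp]] := lying_over (ideal_zero S) (pp 0%N (leqnn _)).
    move=> x; rewrite /zero_ideal -(rmorph0 f) => /f_inj ->.
    by case: (pp 0%N (leqnn _)) => -[].
  exists (fun=> Q); split; first by split.
  by move=> i x; rewrite leqn0 => /eqP ->.
have [||c' [[pc' lc'] c'E]] := IH.
- by move=> i ni; apply: pp; apply: leqW.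
- by move=> i ni; apply: lp; apply: leqW.
have [sub [y py npy]] := lp n (leqnn _).
have [|Q [pQ c'Q QE]] := lying_over (ideal_prime (pc' n (leqnn n))) (pp n.+1 (leqnn _)).
  by move=> x; rewrite c'E // => /sub.
exists (fun i => if (i <= n)%N then c' i else Q); split; last first.
  move=> i x ni; case: (leqP i n) => ni1; first exact: c'E.
  by rewrite QE (_ : i = n.+1) //; apply/eqP; rewrite eqn_leq ni.
split=> i; first by case: (leqP i n) => // ni _; apply: pc'.
rewrite ltnS => ni; rewrite ni; case: (ltnP i n) => [|n1]; first exact: lc'.
have -> : i = n by apply/eqP; rewrite eqn_leq ni.
split=> //; exists (f y); first by rewrite QE.
by rewrite c'E.
Qed.

End IntegralExtension.

Section Veronese.
Variables (K : fieldType) (A : comAlgType K) (G : standard_grading A) (r : nat).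
Hypothesis r_gt0 : (0 < r)%N.

(** A homogeneous [y] is a root of [X^r - y^r]. *)
Lemma veronese_integral : integralRange (val : veronese G r -> A).
Proof.
move=> x; have [N [Gx _ ->]] := hcomp_decomposition G x.
apply: (big_ind (integralOver (val : veronese G r -> A))); first exact: integral0.
  by move=> y z; apply: integral_add.
move=> i _; set y := hcomp G x i.
have Vy : y ^+ r \in veronese_pred G r.
  by apply: (veronese_component (i := i)); rewrite mulnC; apply: componentX; apply: Gx.
apply: (@integral_root_monic _ _ _ _ ('X^r - (y ^+ r)%:P)).
- exact: monicXnsubC.
- by rewrite rootE !hornerE subrr.
apply/integral_poly => k; rewrite coefB coefXn coefC.
apply: integral_sub; first exact: integral_nat.
case: eqP => _; last exact: integral0.
exact: (integral_id _ (Veronese Vy)).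
Qed.

Lemma veronese_krull_dim d : has_krull_dim A d -> has_krull_dim (veronese G r) d.
Proof. exact: (integral_krull_dim (f := val) val_inj veronese_integral). Qed.

Lemma veronese_has_dim i n :
  has_dim (G (i * r)%N) n -> has_dim (@veronese_grading K A G r i) n.
Proof.
move=> [e [e_free eG]].
have Ge k : e k \in G (i * r)%N.
  apply/eG; exists (fun j => if j == k then 1 else 0).
  rewrite (bigD1 k) //= eqxx scale1r big1 ?addr0 // => j /negPf ->.
  by rewrite scale0r.
pose e' k : veronese G r := Veronese (veronese_component (Ge k)).
have valE (c : 'I_n -> K) : val (\sum_k c k *: e' k) = \sum_k c k *: e k.
  by rewrite linear_sum; apply: eq_bigr => k _; rewrite linearZ.
exists e'; split.
  by move=> c c0; apply: e_free; rewrite -valE c0 raddf0.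
move=> v; rewrite -[v \in _]/(val v \in G (i * r)%N); split.
  by case/eG => c vE; exists c; apply: val_inj; rewrite valE.
by case=> c ->; rewrite valE; apply/eG; exists c.
Qed.

End Veronese.

(** * The h-polynomial of a Cohen-Macaulay algebra *)

Section HilbertSeries.
Variables (K : fieldType) (A : comAlgType K) (G : standard_grading A).

Lemma linear_ideal_proper I (ls : seq A) : ideal I -> (forall x, I x -> hcomp G x 0 = 0) ->
  (forall x, x \in ls -> x \in G 1) -> ~ adjoins I ls 1.
Proof.
elim: ls I => [|l ls IH] I iI I0 lG /=.
  by move/I0; rewrite (hcomp_hom _ (component_1 G)) eqxx => /eqP; rewrite oner_eq0.
have Gl : l \in G 1 by apply: lG; rewrite mem_head.
apply: IH; first exact: ideal_adjoin.
  by move=> x [a /I0]; rewrite hcompB (hcompM _ _ Gl) subr0.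
by move=> x xl; apply: lG; rewrite inE xl orbT.
Qed.

(** The [h]-polynomial of a Cohen-Macaulay algebra is the Hilbert series of its quotient
    by a linear system of parameters, hence counts the standard monomials there. *)
Lemma hilbert_function_CM (d : nat) : [pchar K] =i pred0 ->
  has_krull_dim A d -> cohen_macaulay G ->
  exists n (M : pred (seq nat)) (LM : nat -> seq (seq nat)) (h : {poly int}),
    [/\ [/\ forall w, M w -> all (fun x => (x < n)%N) w,
            forall w, M w -> sorted leq w,
            forall u w, subseq u w -> M w -> M u & M [::]],
        enumerates LM M, forall j, h`_j = (size (LM j))%:Z
      & forall j, has_dim (G j) (iter d psum (fun j => size (LM j)) j)].
Proof.
move=> char0 dimA [n [[s [/regular_seq_from rs sG] sn] _] dimA'].
rewrite -(has_krull_dim_uniq dimA dimA') in sn.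
have [ls [lsd lG rls]] := linear_regular_sequence char0 dimA.2 sn sG rs.
have [|N finI] := quotient_finite (G := G) dimA.2 lsd _ rls.
  by move=> x /lG; exists 1%N.
have iZ := ideal_zero A; have hZ := homogeneous_zero G.
set I := adjoins _ ls in finI; have iI : ideal I by apply: ideal_adjoins.
have proper : ~ I 1.
  by apply: (linear_ideal_proper iZ _ lG) => x ->; apply: hcomp0.
have [e ge] := generates1_exists G.
pose LM := standard_words I e N.
have enumLM : enumerates LM (standard I e N) by exact: standard_words_enum.
exists (size e), (standard I e N), LM, (\poly_(j < N) (size (LM j))%:Z); split=> //.
- split; first exact: (standard_lt iI).
  + exact: standard_sorted.
  + exact: (standard_subseq iI).
  exact: standard_nil proper.
- move=> j; rewrite coef_poly; case: ltnP => // Nj.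
  suff -> : LM j = [::] by [].
  case E: (LM j) => [//|w W].
  have := (enumLM j).2 w; rewrite E mem_head => /esym/andP[/(standard_size ge finI) wN].
  by move/eqP=> wj; move: wN; rewrite wj ltnNge Nj.
move=> j; rewrite -lsd.
have [|B bB <-] := dims_adjoins (f := fun j => size (LM j)) iZ hZ lG rls _ j.
  move=> k; exists [seq mon e w | w <- LM k]; last by rewrite size_map.
  exact: (standard_basis iI ge finI).
exact: basis_mod_has_dim bB.
Qed.

End HilbertSeries.

Theorem theorem1p3 (K : fieldType) (char0 : [pchar K] =i pred0)
    (A : comAlgType K) (G : standard_grading A)
    (d : nat) (dimA : has_krull_dim A d) (cmA : cohen_macaulay G)
    (r : nat) (r_ge1 : (1 <= r)%N) :
  let s := (((r - 1) * d) %/ r)%N in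
  let hA := hpoly G in
  let hV := hpoly (@veronese_grading K A G r) in
  [/\ ((deg hA).+1 <= 2 * r)%N -> is_flag_fpoly hV,
      (deg hA <= r)%N -> unimodal hV /\ is_fpoly (gpoly hV)
    & forall i : nat, (2 * i <= s)%N -> hV`_i <= hV`_(s - i)].
Proof.
move=> s hA hV.
have [n [M [LM [h [[M_lt M_sorted M_sub M_nil] LM_enum hE dimG]]]]] :=
  hilbert_function_CM char0 dimA cmA.
pose H := iter d psum (fun j => size (LM j)).
have hAE : hA = h.
  apply: hpolyE; exists d, H; split=> // j.
  by rewrite hE -(conv_iter_psum d (fun j => size (LM j))).
pose P := h * geo r ^+ d.
have hVE i : hV`_i = P`_(i * r).
  rewrite /hV (@hpolyE _ _ _ (\poly_(i < size P) P`_(i * r))).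
    rewrite coef_poly; case: ltnP => // Pi.
    by rewrite nth_default // (leq_trans Pi) // leq_pmulr.
  exists d, (fun i => H (i * r)%N); split.
  - exact: veronese_krull_dim.
  - by move=> j; apply: veronese_has_dim.
  move=> j; rewrite -[RHS](hilbert_veronese d j r_ge1 hE) -/P coef_poly.
  by case: ltnP => // Pj; rewrite nth_default // (leq_trans Pj) // leq_pmulr.
have h_ge0 j : 0 <= h`_j by rewrite hE.
rewrite hAE; split.
- exact: (veronese_flag M_lt M_sorted M_sub M_nil LM_enum r_ge1 hE hVE).
- move=> hr; split; first exact: (veronese_unimodal r_ge1 h_ge0 hVE hr).
  exact: (veronese_gpoly M_lt M_sorted M_sub M_nil LM_enum r_ge1 hE hVE hr).
exact: (veronese_half_symm r_ge1 h_ge0 hVE).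
Qed.
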